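(* Let $\Bbbk$ be a field, $\mathcal C$ a $\Bbbk$-linear monoidal category, $\mathbf M$ a $\mathcal C$-module category and $X\in\mathbf M$. If the presheaf $\mathrm{Hom}_{\mathbf M}(\mathbf M(-)X,X)$ on $\mathcal C$ is representable via a natural isomorphism $\tau:\mathcal C(-,\{X,X\})\xrightarrow{\sim}\mathrm{Hom}_{\mathbf M}(\mathbf M(-)X,X)$, then the monoid structure (for Day convolution) on $\mathcal C(-,\{X,X\})$ obtained by transporting that of $\mathrm{Hom}_{\mathbf M}(\mathbf M(-)X,X)$ along $\tau$ coincides with the one induced, via the monoidal Yoneda embedding, by Ostrik's monoid structure on $\{X,X\}\in\mathcal C$.
   Context: All categories, functors, etc. are $\Bbbk$-linear; $FG$ abbreviates $F\otimes G$ in $\mathcal C$. A $\mathcal C$-module category is a category $\mathbf M$ with a strong monoidal functor $\mathcal C\to\mathrm{End}(\mathbf M)$, $F\mapsto\mathbf MF$, with coherence isomorphisms $\mathbf m_{G,F}:\mathbf MG\,\mathbf MF\Rightarrow\mathbf M(GF)$, $\mathbf m_{\mathbb 1}:\mathrm{Id}\Rightarrow\mathbf M\mathbb 1$. Day convolution on $[\mathcal C^{\mathrm{op}},\mathbf{Vec}_\Bbbk]$: $(P\circledast Q)(F)=\int^{K,L}\mathcal C(F,KL)\otimes P(K)\otimes Q(L)$, with unit $\mathcal C(-,\mathbb 1)$; the Yoneda embedding is strong monoidal. The presheaf $P=\mathrm{Hom}_{\mathbf M}(\mathbf M(-)X,X)$ is a monoid with multiplication $P\circledast P\to P$ induced by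 $b\otimes c\otimes f\mapsto b\circ\mathbf MK(c)\circ(\mathbf m_{K,L})_X^{-1}\circ(\mathbf Mf)_X$ for $b\in P(K)$, $c\in P(L)$, $f\in\mathcal C(F,KL)$, and unit $\mathcal C(F,\mathbb 1)\ni f\mapsto(\mathbf m_{\mathbb 1})_X^{-1}\circ(\mathbf Mf)_X\in P(F)$. Ostrik's monoid structure on $\{X,X\}$: let $\mathrm{ev}_X:\mathbf M\{X,X\}\,X\to X$ be $\tau(\mathrm{id}_{\{X,X\}})$. The multiplication $\{X,X\}\otimes\{X,X\}\to\{X,X\}$ is the morphism corresponding under $\tau$ to $\mathrm{ev}_X\circ\mathbf M\{X,X\}(\mathrm{ev}_X)\circ(\mathbf m_{\{X,X\},\{X,X\}})_X^{-1}$, and the unit $\mathbb 1\to\{X,X\}$ corresponds to $\mathrm{id}_X$ under $\mathrm{Hom}_{\mathbf M}(X,X)\cong\mathrm{Hom}_{\mathbf M}(\mathbf M\mathbb 1\,X,X)\cong\mathcal C(\mathbb 1,\{X,X\})$. *)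

(* Defs.v *)
From HB Require Import structures.
From mathcomp Require Import all_boot all_algebra.
From mathcomp Require Import boolp.

Set Implicit Arguments.
Unset Strict Implicit.
Unset Printing Implicit Defensive.

Import GRing.Theory.
Local Open Scope ring_scope.

Declare Scope cat_scope.
Delimit Scope cat_scope with cat.
Local Open Scope cat_scope.

Reserved Notation "g ∘ f" (at level 40, left associativity).
Reserved Notation "A ⊗ B" (at level 38, left associativity).
Reserved Notation "f ⊗' g" (at level 38, left associativity).

Section LinearMaps.
Variables (k : fieldType) (U V W : lmodType k).

Lemma linear0' (f : U -> V) : linear f -> f 0 = 0.
Proof. by move=> fl; have := fl (-1) 0 0; rewrite scaler0 addr0 scaleN1r addNr. Qed.

Lemma linearD' (f : U -> V) : linear f -> forall x y, f (x + y) = f x + f y.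
Proof. by move=> fl x y; have := fl 1 x y; rewrite !scale1r. Qed.

Lemma linearZ' (f : U -> V) : linear f -> forall a x, f (a *: x) = a *: f x.
Proof. by move=> fl a x; have := fl a x 0; rewrite !addr0 (linear0' fl) addr0. Qed.

Lemma linear_fcomp (g : V -> W) (f : U -> V) :
  linear g -> linear f -> linear (fun x => g (f x)).
Proof. by move=> gl fl a x y; rewrite fl gl. Qed.

End LinearMaps.

(* The k-module presented by generators G and relations R: formal k-linear    *)
(* expressions in G modulo the least congruence containing R and the axioms   *)
(* of k-modules.                                                              *)

Inductive lexpr (k G : Type) : Type :=
  | LGen of G
  | LZero
  | LOpp of lexpr k G
  | LAdd of lexpr k G & lexpr k G
  | LScale of k & lexpr k G.
Arguments LGen {k G}.
Arguments LZero {k G}.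

Section Presented.
Variables (k : fieldType) (G : Type).
Variable R : lexpr k G -> lexpr k G -> Prop.

Inductive lcong : lexpr k G -> lexpr k G -> Prop :=
  | lcong_rel x y : R x y -> lcong x y
  | lcong_refl x : lcong x x
  | lcong_sym x y : lcong x y -> lcong y x
  | lcong_trans x y z : lcong x y -> lcong y z -> lcong x z
  | lcong_opp x x' : lcong x x' -> lcong (LOpp x) (LOpp x')
  | lcong_add x x' y y' :
      lcong x x' -> lcong y y' -> lcong (LAdd x y) (LAdd x' y')
  | lcong_scale a x x' : lcong x x' -> lcong (LScale a x) (LScale a x')
  | lcong_addA x y z : lcong (LAdd x (LAdd y z)) (LAdd (LAdd x y) z)
  | lcong_addC x y : lcong (LAdd x y) (LAdd y x)
  | lcong_add0 x : lcong (LAdd LZero x) x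
  | lcong_addN x : lcong (LAdd (LOpp x) x) LZero
  | lcong_scaleA a b x : lcong (LScale a (LScale b x)) (LScale (a * b) x)
  | lcong_scale1 x : lcong (LScale 1 x) x
  | lcong_scaleDr a x y :
      lcong (LScale a (LAdd x y)) (LAdd (LScale a x) (LScale a y))
  | lcong_scaleDl a b x :
      lcong (LScale (a + b) x) (LAdd (LScale a x) (LScale b x)).

HB.instance Definition _ := gen_eqMixin (lexpr k G).
HB.instance Definition _ := gen_choiceMixin (lexpr k G).

Definition lcongb : rel (lexpr k G) := fun x y => `[< lcong x y >].

Lemma lcongb_refl : reflexive lcongb.
Proof. by move=> x; apply/asboolP; exact: lcong_refl. Qed.
Lemma lcongb_sym : symmetric lcongb.
Proof. by move=> x y; apply/asboolP/asboolP; exact: lcong_sym. Qed.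
Lemma lcongb_trans : transitive lcongb.
Proof.
by move=> y x z /asboolP xy /asboolP yz; apply/asboolP; exact: lcong_trans yz.
Qed.

Canonical lcong_equiv := EquivRel lcongb lcongb_refl lcongb_sym lcongb_trans.

Definition presented : Type := {eq_quot lcong_equiv}%qT.
HB.instance Definition _ := Choice.on presented.

Definition pcls (x : lexpr k G) : presented := \pi_({eq_quot lcong_equiv})%qT x.
Definition prep (x : presented) : lexpr k G := (repr (x : {eq_quot lcong_equiv}))%qT.

Lemma prepK x : pcls (prep x) = x.
Proof. exact: reprK. Qed.

Lemma pclsP x y : lcong x y <-> pcls x = pcls y.
Proof.
split=> [xy|/eqmodP/asboolP//].
by apply/eqmodP/asboolP.
Qed.

Definition padd x y := pcls (LAdd (prep x) (prep y)).
Definition popp x := pcls (LOpp (prep x)).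
Definition pscale a x := pcls (LScale a (prep x)).

Lemma prep_pcls x : lcong (prep (pcls x)) x.
Proof. by apply/pclsP; rewrite prepK. Qed.

Lemma paddE x y : padd (pcls x) (pcls y) = pcls (LAdd x y).
Proof. by apply/pclsP/lcong_add; exact: prep_pcls. Qed.
Lemma poppE x : popp (pcls x) = pcls (LOpp x).
Proof. by apply/pclsP/lcong_opp; exact: prep_pcls. Qed.
Lemma pscaleE a x : pscale a (pcls x) = pcls (LScale a x).
Proof. by apply/pclsP/lcong_scale; exact: prep_pcls. Qed.

Lemma paddA : associative padd.
Proof.
move=> x y z; rewrite -(prepK x) -(prepK y) -(prepK z) !paddE.
by apply/pclsP; exact: lcong_addA.
Qed.
Lemma paddC : commutative padd.
Proof.
move=> x y; rewrite -(prepK x) -(prepK y) !paddE.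
by apply/pclsP; exact: lcong_addC.
Qed.
Lemma padd0 : left_id (pcls LZero) padd.
Proof. by move=> x; rewrite -(prepK x) !paddE; apply/pclsP/lcong_add0. Qed.
Lemma paddN : left_inverse (pcls LZero) popp padd.
Proof. by move=> x; rewrite -(prepK x) poppE paddE; apply/pclsP/lcong_addN. Qed.

HB.instance Definition _ :=
  GRing.isZmodule.Build presented paddA paddC padd0 paddN.

Lemma pscaleA a b x : pscale a (pscale b x) = pscale (a * b) x.
Proof. by rewrite -(prepK x) !pscaleE; apply/pclsP/lcong_scaleA. Qed.
Lemma pscale1 : left_id 1 pscale.
Proof. by move=> x; rewrite -(prepK x) !pscaleE; apply/pclsP/lcong_scale1. Qed.
Lemma pscaleDr : right_distributive pscale +%R.
Proof.
move=> a x y; rewrite -(prepK x) -(prepK y).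
by rewrite /+%R /= paddE !pscaleE paddE; apply/pclsP/lcong_scaleDr.
Qed.
Lemma pscaleDl x : {morph pscale^~ x : a b / a + b}.
Proof.
move=> a b; rewrite -(prepK x) !pscaleE [in RHS]/+%R /= paddE.
by apply/pclsP/lcong_scaleDl.
Qed.

HB.instance Definition _ :=
  GRing.Zmodule_isLmodule.Build k presented pscaleA pscale1 pscaleDr pscaleDl.

Definition pgen (g : G) : presented := pcls (LGen g).

Lemma pcls0 : pcls LZero = 0. Proof. by []. Qed.
Lemma pclsD x y : pcls (LAdd x y) = pcls x + pcls y.
Proof. by rewrite -paddE. Qed.
Lemma pclsN x : pcls (LOpp x) = - pcls x.
Proof. by rewrite -poppE. Qed.
Lemma pclsZ a x : pcls (LScale a x) = a *: pcls x.
Proof. by rewrite -pscaleE. Qed.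

Lemma presented_ind (Q : presented -> Prop) :
    Q 0 -> (forall a x y, Q x -> Q y -> Q (a *: x + y)) ->
    (forall g, Q (pgen g)) ->
  forall x, Q x.
Proof.
move=> Q0 QD Qg x; rewrite -(prepK x).
have QZ a y : Q y -> Q (a *: y) by move=> Qy; rewrite -[_ *: _]addr0; apply: QD.
elim: (prep x) => [g||y IH|y IHy z IHz|a y IH]; first exact: Qg.
- exact: Q0.
- by rewrite pclsN -scaleN1r; exact: QZ.
- by rewrite pclsD -[pcls y]scale1r; exact: QD.
- by rewrite pclsZ; exact: QZ.
Qed.

Section Lift.
Variables (V : lmodType k) (h : G -> V).

Fixpoint leval (x : lexpr k G) : V :=
  match x with
  | LGen g => h g
  | LZero => 0
  | LOpp x => - leval x
  | LAdd x y => leval x + leval y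
  | LScale a x => a *: leval x
  end.

Hypothesis hR : forall x y, R x y -> leval x = leval y.

Lemma leval_cong x y : lcong x y -> leval x = leval y.
Proof.
elim=> //= {x y}.
- by move=> x y z _ -> _ ->.
- by move=> x x' _ ->.
- by move=> x x' y y' _ -> _ ->.
- by move=> a x x' _ ->.
- by move=> x y z; rewrite addrA.
- by move=> x y; rewrite addrC.
- by move=> x; rewrite add0r.
- by move=> x; rewrite addNr.
- by move=> a b x; rewrite scalerA.
- by move=> x; rewrite scale1r.
- by move=> a x y; rewrite scalerDr.
- by move=> a b x; rewrite scalerDl.
Qed.

Definition plift (x : presented) : V := leval (prep x).

Lemma plift_pcls x : plift (pcls x) = leval x.
Proof. by apply: leval_cong; exact: prep_pcls. Qed.

Lemma plift_linear : linear plift.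
Proof.
move=> a x y; rewrite -(prepK x) -(prepK y) -pclsZ -pclsD.
by rewrite !plift_pcls.
Qed.

Lemma plift_gen g : plift (pgen g) = h g.
Proof. exact: plift_pcls. Qed.

End Lift.
End Presented.

(* Plain categories carry the non-linear notions; the carriers lobj and lhom  *)
(* of lincat below live in lower universes, so that pshcat and endcat are     *)
(* again categories.                                                          *)
Record category := Category {
  obj :> Type;
  mor : obj -> obj -> Type;
  idm : forall A, mor A A;
  mcomp : forall A B C, mor B C -> mor A B -> mor A C;
  mcompA : forall A B C D (h : mor C D) (g : mor B C) (f : mor A B),
    mcomp h (mcomp g f) = mcomp (mcomp h g) f;
  comp1m : forall A B (f : mor A B), mcomp (idm B) f = f;
  compm1 : forall A B (f : mor A B), mcomp f (idm A) = f }.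
Arguments mor {c}.
Arguments idm {c}.
Arguments mor : simpl never.
Arguments idm : simpl never.
Arguments mcomp : simpl never.
Notation "g ∘ f" := (mcomp g f) : cat_scope.

Record iso (C : category) (A B : C) := Iso {
  fwd :> mor A B;
  bwd : mor B A;
  fwdK : bwd ∘ fwd = idm A;
  bwdK : fwd ∘ bwd = idm B }.

Record monoidal_structure (C : category) := MonoidalStructure {
  ms_tens : C -> C -> C;
  ms_tensm : forall A A' B B',
    mor A A' -> mor B B' -> mor (ms_tens A B) (ms_tens A' B');
  ms_one : C;
  ms_assoc : forall A B D,
    iso (ms_tens (ms_tens A B) D) (ms_tens A (ms_tens B D));
  ms_lunit : forall A, iso (ms_tens ms_one A) A;
  ms_runit : forall A, iso (ms_tens A ms_one) A;
  ms_tensm1 : forall A B, ms_tensm (idm A) (idm B) = idm (ms_tens A B);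
  ms_tensmM : forall A A' A'' B B' B'' (f : mor A A') (f' : mor A' A'')
      (g : mor B B') (g' : mor B' B''),
    ms_tensm (f' ∘ f) (g' ∘ g) = ms_tensm f' g' ∘ ms_tensm f g;
  ms_assoc_nat : forall A A' B B' D D'
      (f : mor A A') (g : mor B B') (h : mor D D'),
    ms_assoc A' B' D' ∘ ms_tensm (ms_tensm f g) h
    = ms_tensm f (ms_tensm g h) ∘ ms_assoc A B D;
  ms_lunit_nat : forall A A' (f : mor A A'),
    ms_lunit A' ∘ ms_tensm (idm ms_one) f = f ∘ ms_lunit A;
  ms_runit_nat : forall A A' (f : mor A A'),
    ms_runit A' ∘ ms_tensm f (idm ms_one) = f ∘ ms_runit A;
  ms_pentagon : forall A B D E,
    ms_assoc A B (ms_tens D E) ∘ ms_assoc (ms_tens A B) D E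
    = ms_tensm (idm A) (ms_assoc B D E) ∘ ms_assoc A (ms_tens B D) E
        ∘ ms_tensm (ms_assoc A B D) (idm E);
  ms_triangle : forall A B,
    ms_tensm (idm A) (ms_lunit B) ∘ ms_assoc A ms_one B
    = ms_tensm (ms_runit A) (idm B) }.

Record moncat := MonCat {
  mcat :> category;
  mstr : monoidal_structure mcat }.

Definition tens (V : moncat) : V -> V -> V := ms_tens (mstr V).
Definition tensm (V : moncat) (A A' B B' : V) :
  mor A A' -> mor B B' -> mor (tens A B) (tens A' B') := @ms_tensm _ (mstr V) A A' B B'.
Definition tone (V : moncat) : V := ms_one (mstr V).
Definition massoc (V : moncat) (A B D : V) :
  iso (tens (tens A B) D) (tens A (tens B D)) := ms_assoc (mstr V) A B D.
Definition lunit (V : moncat) (A : V) : iso (tens (tone V) A) A := ms_lunit (mstr V) A.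
Definition runit (V : moncat) (A : V) : iso (tens A (tone V)) A := ms_runit (mstr V) A.
Arguments tone {V}.
Notation "A ⊗ B" := (tens A B) : cat_scope.
Notation "f ⊗' g" := (tensm f g) : cat_scope.

Section MoncatLemmas.
Variable V : moncat.
Implicit Types A B D E : V.

Lemma tensm1 A B : idm A ⊗' idm B = idm (A ⊗ B).
Proof. exact: ms_tensm1. Qed.
Lemma tensmM A A' A'' B B' B'' (f : mor A A') (f' : mor A' A'')
    (g : mor B B') (g' : mor B' B'') :
  (f' ∘ f) ⊗' (g' ∘ g) = f' ⊗' g' ∘ (f ⊗' g).
Proof. exact: ms_tensmM. Qed.
Lemma massoc_nat A A' B B' D D' (f : mor A A') (g : mor B B') (h : mor D D') :
  massoc A' B' D' ∘ ((f ⊗' g) ⊗' h) = f ⊗' (g ⊗' h) ∘ massoc A B D.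
Proof. exact: ms_assoc_nat. Qed.
Lemma lunit_nat A A' (f : mor A A') :
  lunit A' ∘ (idm tone ⊗' f) = f ∘ lunit A.
Proof. exact: ms_lunit_nat. Qed.
Lemma runit_nat A A' (f : mor A A') :
  runit A' ∘ (f ⊗' idm tone) = f ∘ runit A.
Proof. exact: ms_runit_nat. Qed.
Lemma pentagon A B D E :
  massoc A B (D ⊗ E) ∘ massoc (A ⊗ B) D E
  = idm A ⊗' massoc B D E ∘ massoc A (B ⊗ D) E ∘ (massoc A B D ⊗' idm E).
Proof. exact: ms_pentagon. Qed.
Lemma triangle A B :
  idm A ⊗' lunit B ∘ massoc A tone B = runit A ⊗' idm B.
Proof. exact: ms_triangle. Qed.

Lemma tensm_split A A' B B' (f : mor A A') (g : mor B B') :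
  f ⊗' idm B' ∘ (idm A ⊗' g) = f ⊗' g.
Proof. by rewrite -tensmM compm1 comp1m. Qed.
Lemma tensm_split' A A' B B' (f : mor A A') (g : mor B B') :
  idm A' ⊗' g ∘ (f ⊗' idm B) = f ⊗' g.
Proof. by rewrite -tensmM compm1 comp1m. Qed.
End MoncatLemmas.

Record strong_monoidal (V W : moncat) := StrongMonoidal {
  sm_obj :> V -> W;
  sm_map : forall A B, mor A B -> mor (sm_obj A) (sm_obj B);
  sm_map1 : forall A, sm_map (idm A) = idm (sm_obj A);
  sm_mapM : forall A B D (g : mor B D) (f : mor A B),
    sm_map (g ∘ f) = sm_map g ∘ sm_map f;
  sm_mul : forall A B, iso (sm_obj A ⊗ sm_obj B) (sm_obj (A ⊗ B));
  sm_one : iso tone (sm_obj tone);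
  sm_mul_nat : forall A A' B B' (f : mor A A') (g : mor B B'),
    sm_mul A' B' ∘ (sm_map f ⊗' sm_map g) = sm_map (f ⊗' g) ∘ sm_mul A B;
  sm_assoc : forall A B D,
    sm_map (massoc A B D) ∘ sm_mul (A ⊗ B) D ∘ (sm_mul A B ⊗' idm (sm_obj D))
    = sm_mul A (B ⊗ D) ∘ (idm (sm_obj A) ⊗' sm_mul B D)
        ∘ massoc (sm_obj A) (sm_obj B) (sm_obj D);
  sm_lunit : forall A,
    sm_map (lunit A) ∘ sm_mul tone A ∘ (sm_one ⊗' idm (sm_obj A))
    = lunit (sm_obj A);
  sm_runit : forall A,
    sm_map (runit A) ∘ sm_mul A tone ∘ (idm (sm_obj A) ⊗' sm_one)
    = runit (sm_obj A) }.

Record monoid_on (V : moncat) (A : V) := MonoidOn {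
  mmul : mor (A ⊗ A) A;
  munit : mor tone A;
  mmulA : mmul ∘ (mmul ⊗' idm A) = mmul ∘ (idm A ⊗' mmul) ∘ massoc A A A;
  mmul1m : mmul ∘ (munit ⊗' idm A) = lunit A;
  mmulm1 : mmul ∘ (idm A ⊗' munit) = runit A }.

Section Transport.
Variables (V : moncat) (A B : V) (t : iso A B) (m : monoid_on B).

Definition transport_mul : mor (A ⊗ A) A := bwd t ∘ mmul m ∘ (t ⊗' t).
Definition transport_unit : mor tone A := bwd t ∘ munit m.

Lemma transport_mulA : transport_mul ∘ (transport_mul ⊗' idm A)
  = transport_mul ∘ (idm A ⊗' transport_mul) ∘ massoc A A A.
Proof.
rewrite /transport_mul.
have E1 : t ⊗' t ∘ ((bwd t ∘ mmul m ∘ (t ⊗' t)) ⊗' idm A)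
   = mmul m ⊗' idm B ∘ ((t ⊗' t) ⊗' t).
  by rewrite -!tensmM !mcompA bwdK compm1 !comp1m.
have E2 : t ⊗' t ∘ (idm A ⊗' (bwd t ∘ mmul m ∘ (t ⊗' t)))
   = idm B ⊗' mmul m ∘ (t ⊗' (t ⊗' t)).
  by rewrite -!tensmM !mcompA bwdK compm1 !comp1m.
rewrite -(mcompA _ (t ⊗' t)) E1 -[in RHS](mcompA _ (t ⊗' t)) E2.
rewrite -!(mcompA (bwd t)); congr (_ ∘ _).
by rewrite mcompA mmulA -!mcompA massoc_nat.
Qed.

Lemma transport_mul1m : transport_mul ∘ (transport_unit ⊗' idm A) = lunit A.
Proof.
rewrite /transport_mul /transport_unit -!mcompA -tensmM [t ∘ (_ ∘ _)]mcompA bwdK comp1m.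
rewrite compm1 -[munit m]compm1 -[in X in _ ⊗' X](comp1m t) tensmM.
by rewrite [mmul m ∘ _]mcompA mmul1m lunit_nat mcompA fwdK comp1m.
Qed.

Lemma transport_mulm1 : transport_mul ∘ (idm A ⊗' transport_unit) = runit A.
Proof.
rewrite /transport_mul /transport_unit -!mcompA -tensmM [t ∘ (_ ∘ _)]mcompA bwdK comp1m.
rewrite compm1 -[munit m]compm1 -[in X in X ⊗' _](comp1m t) tensmM.
by rewrite [mmul m ∘ _]mcompA mmulm1 runit_nat mcompA fwdK comp1m.
Qed.

Definition transport_monoid : monoid_on A :=
  MonoidOn transport_mulA transport_mul1m transport_mulm1.
End Transport.

Section MapMonoid.
Variables (V W : moncat) (F : strong_monoidal V W) (A : V) (m : monoid_on A).

Definition map_mul : mor (F A ⊗ F A) (F A) := sm_map F (mmul m) ∘ sm_mul F A A.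
Definition map_unit : mor tone (F A) := sm_map F (munit m) ∘ sm_one F.

Lemma map_mulA : map_mul ∘ (map_mul ⊗' idm (F A))
  = map_mul ∘ (idm (F A) ⊗' map_mul) ∘ massoc (F A) (F A) (F A).
Proof.
rewrite /map_mul -[in LHS](comp1m (idm (F A))) -[in RHS](comp1m (idm (F A))).
rewrite !tensmM -!(sm_map1 F) -!mcompA.
rewrite [sm_mul _ _ _ ∘ (sm_map F _ ⊗' _ ∘ _)]mcompA sm_mul_nat.
rewrite [in RHS](mcompA (sm_mul F A A) (sm_map F (idm A) ⊗' _)) sm_mul_nat.
rewrite -[in RHS](mcompA _ (sm_mul F A (A ⊗ A))) !mcompA -!sm_mapM mmulA.
rewrite !sm_mapM -!mcompA [in RHS](mcompA (sm_mul F A _)) !sm_map1 -sm_assoc.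
by rewrite !mcompA.
Qed.

Lemma map_mul1m : map_mul ∘ (map_unit ⊗' idm (F A)) = lunit (F A).
Proof.
rewrite /map_mul /map_unit -(comp1m (idm (F A))) tensmM -(sm_map1 F) -!mcompA.
rewrite [sm_mul _ _ _ ∘ (sm_map F _ ⊗' _ ∘ _)]mcompA sm_mul_nat.
by rewrite !mcompA -sm_mapM mmul1m sm_map1 sm_lunit.
Qed.

Lemma map_mulm1 : map_mul ∘ (idm (F A) ⊗' map_unit) = runit (F A).
Proof.
rewrite /map_mul /map_unit -(comp1m (idm (F A))) tensmM -(sm_map1 F) -!mcompA.
rewrite [sm_mul _ _ _ ∘ (sm_map F _ ⊗' _ ∘ _)]mcompA sm_mul_nat.
by rewrite !mcompA -sm_mapM mmulm1 sm_map1 sm_runit.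
Qed.

Definition map_monoid : monoid_on (F A) :=
  MonoidOn map_mulA map_mul1m map_mulm1.
End MapMonoid.

Section LinearCategories.
Variable k : fieldType.

Record lincat := LinCat {
  lobj :> Type;
  lhom : lobj -> lobj -> lmodType k;
  lidm : forall A, lhom A A;
  lcomp : forall A B C, lhom B C -> lhom A B -> lhom A C;
  lcompA : forall A B C D (h : lhom C D) (g : lhom B C) (f : lhom A B),
    lcomp h (lcomp g f) = lcomp (lcomp h g) f;
  lcomp1m : forall A B (f : lhom A B), lcomp (lidm B) f = f;
  lcompm1 : forall A B (f : lhom A B), lcomp f (lidm A) = f;
  lcomp_linl : forall A B C (f : lhom A B),
    linear (fun g : lhom B C => lcomp g f);
  lcomp_linr : forall A B C (g : lhom B C),
    linear (fun f : lhom A B => lcomp g f) }.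

Definition cat_of_lincat (C : lincat) : category :=
  Category (@lcompA C) (@lcomp1m C) (@lcompm1 C).
Coercion cat_of_lincat : lincat >-> category.
Canonical cat_of_lincat.

Record linmoncat := LinMonCat {
  lmcat :> lincat;
  lmstr : monoidal_structure lmcat;
  lmstr_linl : forall (A A' B B' : lmcat) (g : lhom B B'),
    linear (fun f : lhom A A' => ms_tensm lmstr f g : lhom _ _);
  lmstr_linr : forall (A A' B B' : lmcat) (f : lhom A A'),
    linear (fun g : lhom B B' => ms_tensm lmstr f g : lhom _ _) }.

Definition moncat_of_linmoncat (C : linmoncat) : moncat := MonCat (lmstr C).
Coercion moncat_of_linmoncat : linmoncat >-> moncat.
Canonical moncat_of_linmoncat.

Section EndoFunctors.
Variable M : lincat.

Record endofunctor := EndoFunctor {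
  ef_obj :> M -> M;
  ef_map : forall A B : M, mor A B -> mor (ef_obj A) (ef_obj B);
  ef_map1 : forall A : M, ef_map (idm A) = idm (ef_obj A);
  ef_mapM : forall (A B C : M) (g : mor B C) (f : mor A B),
    ef_map (g ∘ f) = ef_map g ∘ ef_map f;
  ef_lin : forall A B : M, linear (@ef_map A B : lhom A B -> lhom _ _) }.

Record nattrans (F G : endofunctor) := NatTrans {
  nt_fun :> forall A : M, mor (F A) (G A);
  nt_nat : forall (A B : M) (f : mor A B),
    nt_fun B ∘ ef_map F f = ef_map G f ∘ nt_fun A }.

Lemma nattrans_ext (F G : endofunctor) (s t : nattrans F G) :
  (forall A, s A = t A) -> s = t.
Proof.
case: s t => [s sn] [t tn] /= st.
have e : s = t by apply: functional_extensionality_dep.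
by case: _ / e tn => tn; rewrite (Prop_irrelevance sn tn).
Qed.

Lemma nt_id_nat (F : endofunctor) (A B : M) (f : mor A B) :
  idm (F B) ∘ ef_map F f = ef_map F f ∘ idm (F A).
Proof. by rewrite comp1m compm1. Qed.
Definition nt_id F : nattrans F F := NatTrans (@nt_id_nat F).

Lemma nt_comp_nat (F G H : endofunctor) (t : nattrans G H) (s : nattrans F G)
    (A B : M) (f : mor A B) :
  t B ∘ s B ∘ ef_map F f = ef_map H f ∘ (t A ∘ s A).
Proof. by rewrite -mcompA nt_nat mcompA nt_nat mcompA. Qed.
Definition nt_comp F G H t s : nattrans F H := NatTrans (@nt_comp_nat F G H t s).

Lemma nt_compA F G H K (u : nattrans H K) (t : nattrans G H) (s : nattrans F G) :
  nt_comp u (nt_comp t s) = nt_comp (nt_comp u t) s.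
Proof. by apply: nattrans_ext => A /=; exact: mcompA. Qed.
Lemma nt_comp1m F G (s : nattrans F G) : nt_comp (nt_id G) s = s.
Proof. by apply: nattrans_ext => A /=; exact: comp1m. Qed.
Lemma nt_compm1 F G (s : nattrans F G) : nt_comp s (nt_id F) = s.
Proof. by apply: nattrans_ext => A /=; exact: compm1. Qed.

Definition endcat : category := Category nt_compA nt_comp1m nt_compm1.

Definition ef_id : endofunctor :=
  @EndoFunctor id (fun _ _ => id) (fun _ => erefl) (fun _ _ _ _ _ => erefl)
    (fun _ _ _ _ _ => erefl).

Lemma ef_comp_map1 (F G : endofunctor) (A : M) :
  ef_map F (ef_map G (idm A)) = idm (F (G A)).
Proof. by rewrite !ef_map1. Qed.
Lemma ef_comp_mapM (F G : endofunctor) (A B C : M) (g : mor B C) (f : mor A B) :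
  ef_map F (ef_map G (g ∘ f)) = ef_map F (ef_map G g) ∘ ef_map F (ef_map G f).
Proof. by rewrite !ef_mapM. Qed.
Definition ef_comp (F G : endofunctor) : endofunctor :=
  @EndoFunctor (fun A => F (G A)) (fun _ _ f => ef_map F (ef_map G f))
    (ef_comp_map1 F G) (@ef_comp_mapM F G)
    (fun A B => linear_fcomp (@ef_lin F _ _) (@ef_lin G A B)).

Lemma nt_hcomp_nat (F F' G G' : endofunctor) (s : nattrans F F')
    (t : nattrans G G') (A B : M) (f : mor A B) :
  s (G' B) ∘ ef_map F (t B) ∘ ef_map (ef_comp F G) f
  = ef_map (ef_comp F' G') f ∘ (s (G' A) ∘ ef_map F (t A)).
Proof. by rewrite /= -mcompA -ef_mapM (nt_nat t) ef_mapM !mcompA (nt_nat s). Qed.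
Definition nt_hcomp F F' G G' (s : nattrans F F') (t : nattrans G G') :
    nattrans (ef_comp F G) (ef_comp F' G') :=
  @NatTrans (ef_comp F G) (ef_comp F' G') (fun A => s (G' A) ∘ ef_map F (t A))
    (@nt_hcomp_nat F F' G G' s t).

(* Composition of endofunctors is strictly associative and unital: the        *)
(* coherence isomorphisms of End(M) have identity components.                 *)
Section StrictIso.
Variables (F G : endofunctor) (i : forall A : M, mor (F A) (G A))
  (j : forall A : M, mor (G A) (F A)).
Hypotheses (i_nat : forall (A B : M) (f : mor A B), i B ∘ ef_map F f = ef_map G f ∘ i A)
  (j_nat : forall (A B : M) (f : mor A B), j B ∘ ef_map G f = ef_map F f ∘ j A)
  (ij : forall A, j A ∘ i A = idm _) (ji : forall A, i A ∘ j A = idm _).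
Lemma nt_isoK : (NatTrans j_nat : mor (c := endcat) G F) ∘ NatTrans i_nat = idm _.
Proof. exact/nattrans_ext. Qed.
Lemma nt_isoK' : (NatTrans i_nat : mor (c := endcat) F G) ∘ NatTrans j_nat = idm _.
Proof. exact/nattrans_ext. Qed.
Definition nt_iso : iso (C := endcat) F G := Iso nt_isoK nt_isoK'.
End StrictIso.

Definition ef_assoc F G H :
    iso (C := endcat) (ef_comp (ef_comp F G) H) (ef_comp F (ef_comp G H)) :=
  @nt_iso (ef_comp (ef_comp F G) H) (ef_comp F (ef_comp G H))
    (fun A => idm (F (G (H A)))) (fun A => idm (F (G (H A))))
    (@nt_id_nat (ef_comp F (ef_comp G H))) (@nt_id_nat (ef_comp F (ef_comp G H)))
    (fun A => comp1m _) (fun A => comp1m _).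
Definition ef_lunit F : iso (C := endcat) (ef_comp ef_id F) F :=
  @nt_iso (ef_comp ef_id F) F (fun A => idm (F A)) (fun A => idm (F A))
    (@nt_id_nat F) (@nt_id_nat F) (fun A => comp1m _) (fun A => comp1m _).
Definition ef_runit F : iso (C := endcat) (ef_comp F ef_id) F :=
  @nt_iso (ef_comp F ef_id) F (fun A => idm (F A)) (fun A => idm (F A))
    (@nt_id_nat F) (@nt_id_nat F) (fun A => comp1m _) (fun A => comp1m _).

Definition End_structure : monoidal_structure endcat.
Proof.
apply: (@MonoidalStructure endcat ef_comp nt_hcomp ef_id ef_assoc ef_lunit ef_runit).
- by move=> F G; apply: nattrans_ext => A /=; rewrite comp1m ef_map1.
- move=> F F' F'' G G' G'' s s' t t'; apply: nattrans_ext => A /=.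
  by rewrite ef_mapM !mcompA; congr (_ ∘ _); rewrite -!mcompA nt_nat.
- move=> F F' G G' H H' s t u; apply: nattrans_ext => A /=.
  by rewrite comp1m compm1 ef_mapM mcompA.
- by move=> F F' s; apply: nattrans_ext => A /=; rewrite !comp1m compm1.
- by move=> F F' s; apply: nattrans_ext => A /=; rewrite ef_map1 comp1m !compm1.
- by move=> F G H K; apply: nattrans_ext => A /=; rewrite !ef_map1 !comp1m.
- by move=> F G; apply: nattrans_ext => A /=; rewrite !ef_map1 !comp1m.
Defined.

Definition End : moncat := MonCat End_structure.

End EndoFunctors.

(* C acts on the left: the tensor product of End(M) is composition of         *)
(* endofunctors, so sm_mul has components M(G) M(F) X -> M(G ⊗ F) X.          *)
Record module_category (C : linmoncat) := ModuleCategory {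
  mod_cat :> lincat;
  mod_act : strong_monoidal C (End mod_cat);
  mod_act_lin : forall (F G : C) (X : mod_cat),
    linear (fun f : lhom F G =>
      (sm_map mod_act f : nattrans (mod_act F) (mod_act G)) X : lhom _ _) }.

End LinearCategories.

Section Presheaves.
Variables (k : fieldType) (C : linmoncat k).

Record presheaf := Presheaf {
  psh_obj :> C -> lmodType k;
  psh_map : forall F G : C, mor F G -> psh_obj G -> psh_obj F;
  psh_map1 : forall (F : C) x, psh_map (idm F) x = x;
  psh_mapM : forall (F G H : C) (g : mor G H) (f : mor F G) x,
    psh_map (g ∘ f) x = psh_map f (psh_map g x);
  psh_map_linr : forall (F G : C) (f : mor F G), linear (psh_map f);
  psh_map_linl : forall (F G : C) (x : psh_obj G),
    linear (fun f : lhom F G => psh_map f x) }.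

Record psh_nat (P Q : presheaf) := PshNat {
  pn_fun :> forall F : C, P F -> Q F;
  pn_lin : forall F : C, linear (@pn_fun F);
  pn_nat : forall (F G : C) (f : mor F G) (x : P G),
    @pn_fun F (psh_map f x) = psh_map f (@pn_fun G x) }.
Arguments pn_fun {P Q} s F x : rename.

Lemma psh_nat_ext (P Q : presheaf) (s t : psh_nat P Q) :
  (forall (F : C) x, s F x = t F x) -> s = t.
Proof.
case: s t => [s sl sn] [t tl tn] /= st.
have e : s = t.
  by apply: functional_extensionality_dep => F; apply/funext; exact: st.
case: _ / e tl tn => tl tn.
by rewrite (Prop_irrelevance sl tl) (Prop_irrelevance sn tn).
Qed.

Definition pn_id P : psh_nat P P :=
  @PshNat P P (fun _ => id) (fun _ _ _ _ => erefl) (fun _ _ _ _ => erefl).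

Lemma pn_comp_nat (P Q S : presheaf) (t : psh_nat Q S) (s : psh_nat P Q)
    (F G : C) (f : mor F G) (x : P G) :
  t F (s F (psh_map f x)) = psh_map f (t G (s G x)).
Proof. by rewrite !pn_nat. Qed.
Definition pn_comp (P Q S : presheaf) (t : psh_nat Q S) (s : psh_nat P Q) :
    psh_nat P S :=
  PshNat (fun F => linear_fcomp (@pn_lin _ _ t F) (@pn_lin _ _ s F))
    (pn_comp_nat t s).

Lemma pn_compA P Q S T (u : psh_nat S T) (t : psh_nat Q S) (s : psh_nat P Q) :
  pn_comp u (pn_comp t s) = pn_comp (pn_comp u t) s.
Proof. exact: psh_nat_ext. Qed.
Lemma pn_comp1m P Q (s : psh_nat P Q) : pn_comp (pn_id Q) s = s.
Proof. exact: psh_nat_ext. Qed.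
Lemma pn_compm1 P Q (s : psh_nat P Q) : pn_comp s (pn_id P) = s.
Proof. exact: psh_nat_ext. Qed.

Definition pshcat : category := Category pn_compA pn_comp1m pn_compm1.

Lemma psh_iso_subproof (P Q : presheaf) (s : psh_nat P Q) (t : psh_nat Q P) :
    (forall (F : C) x, t F (s F x) = x) ->
  (t : mor (c := pshcat) Q P) ∘ s = idm (P : pshcat).
Proof. by move=> ts; apply: psh_nat_ext. Qed.
Definition psh_iso (P Q : presheaf) (s : psh_nat P Q) (t : psh_nat Q P)
    (ts : forall (F : C) x, t F (s F x) = x)
    (st : forall (F : C) x, s F (t F x) = x) : iso (C := pshcat) P Q :=
  Iso (psh_iso_subproof ts) (psh_iso_subproof st).

Lemma yo_map_linr (A : C) (F G : C) (f : mor F G) :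
  linear ((fun x : mor G A => x ∘ f) : lhom G A -> lhom F A).
Proof. exact: lcomp_linl. Qed.
Lemma yo_map_linl (A : C) (F G : C) (x : mor G A) :
  linear ((fun f : mor F G => x ∘ f) : lhom F G -> lhom F A).
Proof. exact: lcomp_linr. Qed.

Definition yo (A : C) : presheaf :=
  @Presheaf (fun F => lhom F A) (fun F G f (x : mor G A) => x ∘ f)
    (fun F (x : mor F A) => compm1 x)
    (fun F G H g f (x : mor H A) => mcompA x g f)
    (@yo_map_linr A) (@yo_map_linl A).

Lemma yo_hom_lin (A B : C) (g : mor A B) (F : C) :
  linear ((fun x : mor F A => g ∘ x) : lhom F A -> lhom F B).
Proof. exact: lcomp_linr. Qed.
Definition yo_hom (A B : C) (g : mor A B) : psh_nat (yo A) (yo B) :=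
  @PshNat (yo A) (yo B) (fun F (x : mor F A) => g ∘ x) (yo_hom_lin g)
    (fun F G f (x : mor G A) => mcompA g x f).

(* Day convolution: the coend                                                 *)
(*   (P ⊛ Q)(F) = ∫^{K,L} C(F, K ⊗ L) ⊗ P(K) ⊗ Q(L)                           *)
(* presented by the generators f ⊗ p ⊗ q, subject to trilinearity and         *)
(* dinaturality in (K, L). Its universal property is day_lift (existence) and *)
(* day_ext (uniqueness).                                                      *)

Record day_gen (P Q : presheaf) (F : C) := DayGen {
  dg_K : C; dg_L : C; dg_hom : mor F (dg_K ⊗ dg_L); dg_l : P dg_K; dg_r : Q dg_L }.
Arguments DayGen {P Q F K L} : rename.

Inductive day_rel (P Q : presheaf) (F : C) :
    lexpr k (day_gen P Q F) -> lexpr k (day_gen P Q F) -> Prop :=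
  | day_rel_hom (K L : C) a (f f' : lhom F (K ⊗ L)) (p : P K) (q : Q L) :
      day_rel (LGen (DayGen (a *: f + f' : lhom _ _) p q))
        (LAdd (LScale a (LGen (DayGen f p q))) (LGen (DayGen f' p q)))
  | day_rel_l (K L : C) (f : mor F (K ⊗ L)) a (p p' : P K) (q : Q L) :
      day_rel (LGen (DayGen f (a *: p + p') q))
        (LAdd (LScale a (LGen (DayGen f p q))) (LGen (DayGen f p' q)))
  | day_rel_r (K L : C) (f : mor F (K ⊗ L)) (p : P K) a (q q' : Q L) :
      day_rel (LGen (DayGen f p (a *: q + q')))
        (LAdd (LScale a (LGen (DayGen f p q))) (LGen (DayGen f p q')))
  | day_rel_dinat (K K' L L' : C) (u : mor K K') (v : mor L L')
        (f : mor F (K ⊗ L)) (p : P K') (q : Q L') :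
      day_rel (LGen (DayGen (u ⊗' v ∘ f) p q))
        (LGen (DayGen f (psh_map u p) (psh_map v q))).

Definition day_obj (P Q : presheaf) (F : C) : lmodType k :=
  presented (@day_rel P Q F).

Definition dgen (P Q : presheaf) (F K L : C) (f : mor F (K ⊗ L)) (p : P K)
  (q : Q L) : day_obj P Q F := pgen (@day_rel P Q F) (DayGen f p q).
Arguments dgen {P Q F K L}.

Section DayUniversal.
Variables (P Q : presheaf) (F : C).

Lemma dgen_lin_hom (K L : C) (p : P K) (q : Q L) :
  linear ((fun f => dgen f p q) : lhom F (K ⊗ L) -> day_obj P Q F).
Proof.
move=> a f f'; rewrite -[_ *: dgen _ _ _]pclsZ -[in RHS]pclsD.
by apply/pclsP/lcong_rel/day_rel_hom.
Qed.
Lemma dgen_lin_l (K L : C) (f : mor F (K ⊗ L)) (q : Q L) :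
  linear (fun p : P K => dgen f p q).
Proof.
move=> a p p'; rewrite -[_ *: dgen _ _ _]pclsZ -[in RHS]pclsD.
by apply/pclsP/lcong_rel/day_rel_l.
Qed.
Lemma dgen_lin_r (K L : C) (f : mor F (K ⊗ L)) (p : P K) :
  linear (fun q : Q L => dgen f p q).
Proof.
move=> a q q'; rewrite -[_ *: dgen _ _ _]pclsZ -[in RHS]pclsD.
by apply/pclsP/lcong_rel/day_rel_r.
Qed.
Lemma dgen_complin_l (U : lmodType k) (K L : C) (f : mor F (K ⊗ L)) (g : U -> P K)
    (q : Q L) :
  linear g -> linear (fun u => dgen f (g u) q).
Proof. by move=> gl; exact: (linear_fcomp (dgen_lin_l f q) gl). Qed.
Lemma dgen_complin_r (U : lmodType k) (K L : C) (f : mor F (K ⊗ L)) (p : P K)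
    (g : U -> Q L) :
  linear g -> linear (fun u => dgen f p (g u)).
Proof. by move=> gl; exact: (linear_fcomp (dgen_lin_r f p) gl). Qed.
Lemma dgen_dinat (K K' L L' : C) (u : mor K K') (v : mor L L')
    (f : mor F (K ⊗ L)) (p : P K') (q : Q L') :
  dgen (u ⊗' v ∘ f) p q = dgen f (psh_map u p) (psh_map v q).
Proof. by apply/pclsP/lcong_rel/day_rel_dinat. Qed.
Lemma dgen_dinatl (K K' L : C) (u : mor K K') (f : mor F (K ⊗ L)) (p : P K')
    (q : Q L) :
  dgen f (psh_map u p) q = dgen (u ⊗' idm L ∘ f) p q.
Proof. by rewrite dgen_dinat psh_map1. Qed.
Lemma dgen_dinatr (K L L' : C) (v : mor L L') (f : mor F (K ⊗ L)) (p : P K)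
    (q : Q L') :
  dgen f p (psh_map v q) = dgen (idm K ⊗' v ∘ f) p q.
Proof. by rewrite dgen_dinat psh_map1. Qed.

Lemma day_ind (Z : day_obj P Q F -> Prop) :
    Z 0 -> (forall a x y, Z x -> Z y -> Z (a *: x + y)) ->
    (forall (K L : C) (f : mor F (K ⊗ L)) p q, Z (dgen f p q)) ->
  forall x, Z x.
Proof. by move=> Z0 ZD Zg; apply: presented_ind => // -[]. Qed.

Lemma day_ext (V : lmodType k) (g h : day_obj P Q F -> V) :
    linear g -> linear h ->
    (forall (K L : C) (f : mor F (K ⊗ L)) p q, g (dgen f p q) = h (dgen f p q)) ->
  forall x, g x = h x.
Proof.
move=> gl hl gh; apply: day_ind => // [|a x y gx gy].
  by rewrite !linear0'.
by rewrite gl hl gx gy.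
Qed.

Section Lift.
Variables (V : lmodType k)
  (h : forall K L : C, mor F (K ⊗ L) -> P K -> Q L -> V).
Hypotheses
  (h_hom : forall (K L : C) p q,
     linear ((fun f => h f p q) : lhom F (K ⊗ L) -> V))
  (h_l : forall (K L : C) (f : mor F (K ⊗ L)) q, linear (fun p => h f p q))
  (h_r : forall (K L : C) (f : mor F (K ⊗ L)) p, linear (fun q => h f p q))
  (h_dinat : forall (K K' L L' : C) (u : mor K K') (v : mor L L')
      (f : mor F (K ⊗ L)) p q,
     h (u ⊗' v ∘ f) p q = h f (psh_map u p) (psh_map v q)).

Let h' (g : day_gen P Q F) : V := h (dg_hom g) (dg_l g) (dg_r g).

Lemma day_lift_subproof x y : day_rel x y -> leval h' x = leval h' y.
Proof.
case=> [K L a f f' p q|K L f a p p' q|K L f p a q q'|K K' L L' u v f p q] /=.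
- exact: h_hom.
- exact: h_l.
- exact: h_r.
- exact: h_dinat.
Qed.

Definition day_lift : day_obj P Q F -> V := plift h'.

Lemma day_lift_lin : linear day_lift.
Proof. exact: plift_linear day_lift_subproof. Qed.
Lemma day_lift_gen (K L : C) (f : mor F (K ⊗ L)) p q :
  day_lift (dgen f p q) = h f p q.
Proof. exact: (plift_gen day_lift_subproof). Qed.
End Lift.
End DayUniversal.

Section DayFunctor.
Variables P Q : presheaf.

Section DayMap.
Variables (F G : C) (f : mor F G).
Definition day_map : day_obj P Q G -> day_obj P Q F :=
  day_lift (fun (K L : C) (g : mor G (K ⊗ L)) p q => dgen (g ∘ f) p q).
Fact day_map_hom (K L : C) (p : P K) (q : Q L) :
  linear ((fun g : mor G (K ⊗ L) => dgen (g ∘ f) p q) : lhom G (K ⊗ L) -> day_obj P Q F).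
Proof.
exact: (linear_fcomp (dgen_lin_hom _ _) (yo_map_linr f)).
Qed.
Fact day_map_dinat (K K' L L' : C) (u : mor K K') (v : mor L L')
    (g : mor G (K ⊗ L)) (p : P K') (q : Q L') :
  dgen (u ⊗' v ∘ g ∘ f) p q = dgen (g ∘ f) (psh_map u p) (psh_map v q).
Proof. by rewrite -mcompA dgen_dinat. Qed.
Lemma day_map_lin : linear day_map.
Proof.
apply: day_lift_lin => *;
  [exact: day_map_hom|exact: dgen_lin_l|exact: dgen_lin_r|exact: day_map_dinat].
Qed.
Lemma day_mapE (K L : C) (g : mor G (K ⊗ L)) p q :
  day_map (dgen g p q) = dgen (g ∘ f) p q.
Proof.
apply: day_lift_gen => *;
  [exact: day_map_hom|exact: dgen_lin_l|exact: dgen_lin_r|exact: day_map_dinat].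
Qed.
End DayMap.

Lemma day_map1 (F : C) x : day_map (idm F) x = x.
Proof.
move: x; apply: (day_ext (day_map_lin _) (fun _ _ _ => erefl)) => K L f p q.
by rewrite day_mapE compm1.
Qed.
Lemma day_mapM (F G H : C) (g : mor G H) (f : mor F G) x :
  day_map (g ∘ f) x = day_map f (day_map g x).
Proof.
move: x; apply: (day_ext (day_map_lin _)
  (linear_fcomp (day_map_lin f) (day_map_lin g))) => K L h p q.
by rewrite !day_mapE mcompA.
Qed.
Lemma day_map_linl (F G : C) x :
  linear ((fun f => day_map f x) : lhom F G -> day_obj P Q F).
Proof.
move=> a f f'; move: x; apply: day_ind => [|b x y IHx IHy|K L g p q].
- by rewrite !(linear0' (day_map_lin _)) scaler0 addr0.
- rewrite !day_map_lin IHx IHy !scalerDr !scalerA mulrC.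
  by rewrite -!addrA; congr (_ + _); rewrite addrCA.
- rewrite !day_mapE.
  exact: (linear_fcomp (dgen_lin_hom p q) (yo_map_linl g)).
Qed.

Definition day : presheaf :=
  Presheaf day_map1 day_mapM day_map_lin day_map_linl.

End DayFunctor.

Section DayHom.
Variables (P P' Q Q' : presheaf) (s : psh_nat P P') (t : psh_nat Q Q').
Section Comp.
Variable F : C.
Definition day_hom_fun : day P Q F -> day P' Q' F :=
  day_lift (fun (K L : C) (f : mor F (K ⊗ L)) p q => dgen f (s K p) (t L q)).
Fact day_hom_l (K L : C) (f : mor F (K ⊗ L)) q :
  linear (fun p => dgen f (s K p) (t L q)).
Proof.
by apply: (linear_fcomp (g := fun p => dgen f p (t L q)));
  [exact: dgen_lin_l|exact: pn_lin].
Qed.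
Fact day_hom_r (K L : C) (f : mor F (K ⊗ L)) p :
  linear (fun q => dgen f (s K p) (t L q)).
Proof.
by apply: (linear_fcomp (g := fun q => dgen f (s K p) q));
  [exact: dgen_lin_r|exact: pn_lin].
Qed.
Fact day_hom_dinat (K K' L L' : C) (u : mor K K') (v : mor L L')
    (f : mor F (K ⊗ L)) p q :
  dgen (u ⊗' v ∘ f) (s K' p) (t L' q)
  = dgen f (s K (psh_map u p)) (t L (psh_map v q)).
Proof. by rewrite dgen_dinat !pn_nat. Qed.
Lemma day_hom_lin : linear day_hom_fun.
Proof.
apply: day_lift_lin => *;
  [exact: dgen_lin_hom|exact: day_hom_l|exact: day_hom_r|exact: day_hom_dinat].
Qed.
Lemma day_hom_gen (K L : C) (f : mor F (K ⊗ L)) p q :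
  day_hom_fun (dgen f p q) = dgen f (s K p) (t L q).
Proof.
apply: day_lift_gen => *;
  [exact: dgen_lin_hom|exact: day_hom_l|exact: day_hom_r|exact: day_hom_dinat].
Qed.
End Comp.

Lemma day_hom_nat (F G : C) (f : mor F G) (x : day P Q G) :
  day_hom_fun (psh_map f x) = psh_map f (day_hom_fun x).
Proof.
move: x; apply: (day_ext (linear_fcomp (@day_hom_lin F) (day_map_lin f))
  (linear_fcomp (day_map_lin f) (@day_hom_lin G))) => K L g p q.
by rewrite /= day_mapE !day_hom_gen day_mapE.
Qed.

Definition day_hom : psh_nat (day P Q) (day P' Q') :=
  PshNat day_hom_lin day_hom_nat.

End DayHom.

Lemma day_lin2 (P Q : presheaf) (F : C) (U V : lmodType k)
    (A : U -> day P Q F -> V) :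
    (forall u, linear (A u)) ->
    (forall (K L : C) (f : mor F (K ⊗ L)) p q, linear (fun u => A u (dgen f p q))) ->
  forall x, linear (fun u => A u x).
Proof.
move=> Al Ag x a u u'; move: x; apply: day_ext => //; last first.
  by move=> K L f p q; rewrite Ag.
move=> b x y; rewrite !Al !scalerDr !scalerA mulrC.
by rewrite -!addrA; congr (_ + _); rewrite addrCA.
Qed.

Lemma day_ext3l (P Q S : presheaf) (F : C) (V : lmodType k)
    (g h : day (day P Q) S F -> V) :
    linear g -> linear h ->
    (forall (K L : C) (f : mor F (K ⊗ L)) (K1 K2 : C) (e : mor K (K1 ⊗ K2)) p q r,
      g (dgen f (dgen e p q : day P Q K) r) = h (dgen f (dgen e p q : day P Q K) r)) ->
  forall x, g x = h x.
Proof.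
move=> gl hl gh; apply: day_ext => // K L f x r; move: x.
by apply: (day_ext (linear_fcomp gl (dgen_lin_l f r))
  (linear_fcomp hl (dgen_lin_l f r))) => *; exact: gh.
Qed.

Lemma day_ext3r (P Q S : presheaf) (F : C) (V : lmodType k)
    (g h : day P (day Q S) F -> V) :
    linear g -> linear h ->
    (forall (K L : C) (f : mor F (K ⊗ L)) (L1 L2 : C) (e : mor L (L1 ⊗ L2)) p q r,
      g (dgen f p (dgen e q r : day Q S L)) = h (dgen f p (dgen e q r : day Q S L))) ->
  forall x, g x = h x.
Proof.
move=> gl hl gh; apply: day_ext => // K L f p x; move: x.
by apply: (day_ext (linear_fcomp gl (dgen_lin_r f p))
  (linear_fcomp hl (dgen_lin_r f p))) => *; exact: gh.
Qed.

Lemma day_ext4 (P Q S T : presheaf) (F : C) (V : lmodType k)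
    (g h : day (day (day P Q) S) T F -> V) :
    linear g -> linear h ->
    (forall (K L : C) (f : mor F (K ⊗ L)) (K1 K2 : C) (e : mor K (K1 ⊗ K2))
        (J1 J2 : C) (d : mor K1 (J1 ⊗ J2)) p q r t,
      g (dgen f (dgen e (dgen d p q : day P Q K1) r : day (day P Q) S K) t)
      = h (dgen f (dgen e (dgen d p q : day P Q K1) r : day (day P Q) S K) t)) ->
  forall x, g x = h x.
Proof.
move=> gl hl gh; apply: day_ext3l => // K L f K1 K2 e x r t; move: x.
have lin g' : linear g' ->
    linear (fun x : day P Q K1 => g' (dgen f (dgen e x r : day (day P Q) S K) t) : V).
  move=> g'l; apply: (linear_fcomp g'l).
  by apply: dgen_complin_l; exact: dgen_lin_l.
by apply: (day_ext (lin g gl) (lin h hl)) => *; exact: gh.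
Qed.

Lemma tensm_linl (A A' B B' : C) (g : mor B B') :
  linear ((fun f : mor A A' => f ⊗' g) : lhom A A' -> lhom (A ⊗ B) (A' ⊗ B')).
Proof. exact: lmstr_linl. Qed.
Lemma tensm_linr (A A' B B' : C) (f : mor A A') :
  linear ((fun g : mor B B' => f ⊗' g) : lhom B B' -> lhom (A ⊗ B) (A' ⊗ B')).
Proof. exact: lmstr_linr. Qed.

Section DayAssoc.
Variables P Q S : presheaf.

Section Inner.
Variables (F K L : C) (f : mor F (K ⊗ L)) (r : S L).
Definition assoc_in : day P Q K -> day P (day Q S) F :=
  day_lift (fun (K1 K2 : C) (g : mor K (K1 ⊗ K2)) p q =>
    dgen (massoc K1 K2 L ∘ (g ⊗' idm L) ∘ f) p
      (dgen (idm (K2 ⊗ L)) q r : day Q S (K2 ⊗ L))).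
Fact assoc_in_hom (K1 K2 : C) (p : P K1) (q : day Q S (K2 ⊗ L)) :
  linear ((fun g : mor K (K1 ⊗ K2) =>
    dgen (massoc K1 K2 L ∘ (g ⊗' idm L) ∘ f) p q)
    : lhom K (K1 ⊗ K2) -> day P (day Q S) F).
Proof.
apply: (linear_fcomp (dgen_lin_hom _ _)).
apply: (linear_fcomp (yo_map_linr f)).
exact: (linear_fcomp (yo_map_linl _) (tensm_linl _)).
Qed.
Fact assoc_in_r (K1 K2 : C) (h : mor F (K1 ⊗ (K2 ⊗ L))) (p : P K1) :
  linear (fun q : Q K2 => dgen h p (dgen (idm (K2 ⊗ L)) q r : day Q S (K2 ⊗ L))).
Proof. by apply: dgen_complin_r; exact: dgen_lin_l. Qed.
Fact assoc_in_dinat (K1 K1' K2 K2' : C) (u : mor K1 K1') (v : mor K2 K2')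
    (g : mor K (K1 ⊗ K2)) (p : P K1') (q : Q K2') :
  dgen (massoc K1' K2' L ∘ ((u ⊗' v ∘ g) ⊗' idm L) ∘ f) p
    (dgen (idm (K2' ⊗ L)) q r : day Q S (K2' ⊗ L))
  = dgen (massoc K1 K2 L ∘ (g ⊗' idm L) ∘ f) (psh_map u p)
      (dgen (idm (K2 ⊗ L)) (psh_map v q) r : day Q S (K2 ⊗ L)).
Proof.
rewrite -[idm L](comp1m (idm L)) tensmM !comp1m mcompA massoc_nat.
rewrite -!mcompA dgen_dinat /= day_mapE comp1m.
by rewrite -[v ⊗' idm L]compm1 dgen_dinat psh_map1.
Qed.
Lemma assoc_in_lin : linear assoc_in.
Proof.
apply: day_lift_lin => *;
  [exact: assoc_in_hom|exact: dgen_lin_l|exact: assoc_in_r|exact: assoc_in_dinat].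
Qed.
Lemma assoc_in_gen (K1 K2 : C) (g : mor K (K1 ⊗ K2)) p q :
  assoc_in (dgen g p q) = dgen (massoc K1 K2 L ∘ (g ⊗' idm L) ∘ f) p
      (dgen (idm (K2 ⊗ L)) q r : day Q S (K2 ⊗ L)).
Proof.
apply: day_lift_gen => *;
  [exact: assoc_in_hom|exact: dgen_lin_l|exact: assoc_in_r|exact: assoc_in_dinat].
Qed.
End Inner.

Section Outer.
Variable F : C.
Definition assoc_out : day (day P Q) S F -> day P (day Q S) F :=
  day_lift (fun (K L : C) (f : mor F (K ⊗ L)) x r => assoc_in f r x).
Fact assoc_out_hom (K L : C) x r :
  linear ((fun f : mor F (K ⊗ L) => assoc_in f r x)
    : lhom F (K ⊗ L) -> day P (day Q S) F).
Proof.
move: x; apply: (day_lin2 (fun f => assoc_in_lin _ r)) => K1 K2 g p q.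
move=> a f f'; rewrite !assoc_in_gen.
exact: (linear_fcomp (dgen_lin_hom _ _) (yo_map_linl _)).
Qed.
Fact assoc_out_r (K L : C) (f : mor F (K ⊗ L)) x :
  linear (fun r => assoc_in f r x).
Proof.
move: x; apply: (day_lin2 (assoc_in_lin f)) => K1 K2 g p q a r r'.
rewrite !assoc_in_gen.
by apply: dgen_complin_r; exact: dgen_lin_r.
Qed.
Fact assoc_out_dinat (K K' L L' : C) (u : mor K K') (v : mor L L')
    (f : mor F (K ⊗ L)) (x : day P Q K') (r : S L') :
  assoc_in (u ⊗' v ∘ f) r x = assoc_in f (psh_map v r) (psh_map u x).
Proof.
move: x; apply: day_ext.
- exact: assoc_in_lin.
- exact: (linear_fcomp (assoc_in_lin _ _) (day_map_lin u)).
move=> K1 K2 g p q; rewrite /= day_mapE !assoc_in_gen dgen_dinatr.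
have -> : dgen (idm K2 ⊗' v ∘ idm (K2 ⊗ L)) q r
    = psh_map (idm K2 ⊗' v) (dgen (idm (K2 ⊗ L')) q r : day Q S (K2 ⊗ L')).
  by rewrite /= day_mapE compm1 comp1m.
rewrite dgen_dinatr !mcompA -massoc_nat; congr (dgen _ _ _).
rewrite -!mcompA; congr (_ ∘ _); rewrite !mcompA; congr (_ ∘ _).
by rewrite tensm1 -!tensmM !comp1m compm1.
Qed.
Lemma assoc_out_lin : linear assoc_out.
Proof.
apply: day_lift_lin => *;
  [exact: assoc_out_hom|exact: assoc_in_lin|exact: assoc_out_r|exact: assoc_out_dinat].
Qed.
Lemma assoc_out_gen (K L : C) (f : mor F (K ⊗ L)) x r :
  assoc_out (dgen f x r) = assoc_in f r x.
Proof.
apply: day_lift_gen => *;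
  [exact: assoc_out_hom|exact: assoc_in_lin|exact: assoc_out_r|exact: assoc_out_dinat].
Qed.
Lemma assoc_outE (K L : C) (f : mor F (K ⊗ L)) (K1 K2 : C) (g : mor K (K1 ⊗ K2))
    p q r :
  assoc_out (dgen f (dgen g p q : day P Q K) r)
  = dgen (massoc K1 K2 L ∘ (g ⊗' idm L) ∘ f) p
      (dgen (idm (K2 ⊗ L)) q r : day Q S (K2 ⊗ L)).
Proof. by rewrite assoc_out_gen assoc_in_gen. Qed.
End Outer.

Lemma assoc_out_nat (F G : C) (f : mor F G) (x : day (day P Q) S G) :
  assoc_out (psh_map f x) = psh_map f (assoc_out x).
Proof.
move: x; apply: (day_ext3l (linear_fcomp (@assoc_out_lin F) (day_map_lin f))
  (linear_fcomp (day_map_lin f) (@assoc_out_lin G))) => K L g K1 K2 e p q r.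
by rewrite /= day_mapE !assoc_outE day_mapE mcompA.
Qed.

Definition day_assoc : psh_nat (day (day P Q) S) (day P (day Q S)) :=
  PshNat assoc_out_lin assoc_out_nat.

Section InvInner.
Variables (F K L : C) (f : mor F (K ⊗ L)) (p : P K).
Definition associ_in : day Q S L -> day (day P Q) S F :=
  day_lift (fun (L1 L2 : C) (g : mor L (L1 ⊗ L2)) q r =>
    dgen (bwd (massoc K L1 L2) ∘ (idm K ⊗' g) ∘ f)
      (dgen (idm (K ⊗ L1)) p q : day P Q (K ⊗ L1)) r).
Fact associ_in_hom (L1 L2 : C) (x : day P Q (K ⊗ L1)) (r : S L2) :
  linear ((fun g : mor L (L1 ⊗ L2) =>
    dgen (bwd (massoc K L1 L2) ∘ (idm K ⊗' g) ∘ f) x r)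
    : lhom L (L1 ⊗ L2) -> day (day P Q) S F).
Proof.
apply: (linear_fcomp (dgen_lin_hom _ _)).
apply: (linear_fcomp (yo_map_linr f)).
exact: (linear_fcomp (yo_map_linl _) (tensm_linr _)).
Qed.
Fact associ_in_l (L1 L2 : C) (h : mor F ((K ⊗ L1) ⊗ L2)) (r : S L2) :
  linear (fun q : Q L1 => dgen h (dgen (idm (K ⊗ L1)) p q : day P Q (K ⊗ L1)) r).
Proof. by apply: dgen_complin_l; exact: dgen_lin_r. Qed.
Fact massoci_nat (A A' B B' D D' : C) (u : mor A A') (v : mor B B') (w : mor D D') :
  bwd (massoc A' B' D') ∘ (u ⊗' (v ⊗' w)) = (u ⊗' v) ⊗' w ∘ bwd (massoc A B D).
Proof.
rewrite -[u ⊗' (v ⊗' w)]compm1 -(bwdK (massoc A B D)) (mcompA (u ⊗' _)).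
by rewrite -massoc_nat !mcompA fwdK comp1m.
Qed.
Fact associ_in_dinat (L1 L1' L2 L2' : C) (u : mor L1 L1') (v : mor L2 L2')
    (g : mor L (L1 ⊗ L2)) (q : Q L1') (r : S L2') :
  dgen (bwd (massoc K L1' L2') ∘ (idm K ⊗' (u ⊗' v ∘ g)) ∘ f)
    (dgen (idm (K ⊗ L1')) p q : day P Q (K ⊗ L1')) r
  = dgen (bwd (massoc K L1 L2) ∘ (idm K ⊗' g) ∘ f)
      (dgen (idm (K ⊗ L1)) p (psh_map u q) : day P Q (K ⊗ L1)) (psh_map v r).
Proof.
rewrite -[idm K](comp1m (idm K)) tensmM !comp1m mcompA massoci_nat.
rewrite -!mcompA dgen_dinat /= day_mapE comp1m.
by rewrite -[idm K ⊗' u]compm1 dgen_dinat psh_map1.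
Qed.
Lemma associ_in_lin : linear associ_in.
Proof.
apply: day_lift_lin => *;
  [exact: associ_in_hom|exact: associ_in_l|exact: dgen_lin_r|exact: associ_in_dinat].
Qed.
Lemma associ_in_gen (L1 L2 : C) (g : mor L (L1 ⊗ L2)) q r :
  associ_in (dgen g q r) = dgen (bwd (massoc K L1 L2) ∘ (idm K ⊗' g) ∘ f)
      (dgen (idm (K ⊗ L1)) p q : day P Q (K ⊗ L1)) r.
Proof.
apply: day_lift_gen => *;
  [exact: associ_in_hom|exact: associ_in_l|exact: dgen_lin_r|exact: associ_in_dinat].
Qed.
End InvInner.

Section InvOuter.
Variable F : C.
Definition associ_out : day P (day Q S) F -> day (day P Q) S F :=
  day_lift (fun (K L : C) (f : mor F (K ⊗ L)) p y => associ_in f p y).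
Fact associ_out_hom (K L : C) p y :
  linear ((fun f : mor F (K ⊗ L) => associ_in f p y)
    : lhom F (K ⊗ L) -> day (day P Q) S F).
Proof.
move: y; apply: (day_lin2 (fun f => associ_in_lin _ p)) => L1 L2 g q r.
move=> a f f'; rewrite !associ_in_gen.
exact: (linear_fcomp (dgen_lin_hom _ _) (yo_map_linl _)).
Qed.
Fact associ_out_l (K L : C) (f : mor F (K ⊗ L)) y :
  linear (fun p => associ_in f p y).
Proof.
move: y; apply: (day_lin2 (associ_in_lin f)) => L1 L2 g q r a p p'.
rewrite !associ_in_gen.
pose g' p0 : day P Q (K ⊗ L1) := dgen (idm (K ⊗ L1)) p0 q.
have g'l : linear g' by exact: dgen_lin_l.
exact: (@dgen_complin_l _ _ F _ _ _ (bwd (massoc K L1 L2) ∘ (idm K ⊗' g) ∘ f)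
  g' r g'l).
Qed.
Fact associ_out_dinat (K K' L L' : C) (u : mor K K') (v : mor L L')
    (f : mor F (K ⊗ L)) (p : P K') (y : day Q S L') :
  associ_in (u ⊗' v ∘ f) p y = associ_in f (psh_map u p) (psh_map v y).
Proof.
move: y; apply: day_ext.
- exact: associ_in_lin.
- exact: (linear_fcomp (associ_in_lin _ _) (day_map_lin v)).
move=> L1 L2 g q r; rewrite /= day_mapE !associ_in_gen dgen_dinatl.
have -> : dgen (u ⊗' idm L1 ∘ idm (K ⊗ L1)) p q
    = psh_map (u ⊗' idm L1) (dgen (idm (K' ⊗ L1)) p q : day P Q (K' ⊗ L1)).
  by rewrite /= day_mapE compm1 comp1m.
rewrite dgen_dinatl !mcompA -massoci_nat; congr (dgen _ _ _).
rewrite -!mcompA; congr (_ ∘ _); rewrite !mcompA; congr (_ ∘ _).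
by rewrite tensm1 -!tensmM !comp1m compm1.
Qed.
Lemma associ_out_lin : linear associ_out.
Proof.
apply: day_lift_lin => *;
  [exact: associ_out_hom|exact: associ_out_l|exact: associ_in_lin
  |exact: associ_out_dinat].
Qed.
Lemma associ_out_gen (K L : C) (f : mor F (K ⊗ L)) p y :
  associ_out (dgen f p y) = associ_in f p y.
Proof.
apply: day_lift_gen => *;
  [exact: associ_out_hom|exact: associ_out_l|exact: associ_in_lin
  |exact: associ_out_dinat].
Qed.
Lemma associ_outE (K L : C) (f : mor F (K ⊗ L)) (L1 L2 : C) (g : mor L (L1 ⊗ L2))
    p q r :
  associ_out (dgen f p (dgen g q r : day Q S L))
  = dgen (bwd (massoc K L1 L2) ∘ (idm K ⊗' g) ∘ f)
      (dgen (idm (K ⊗ L1)) p q : day P Q (K ⊗ L1)) r.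
Proof. by rewrite associ_out_gen associ_in_gen. Qed.

Lemma assoc_outK x : associ_out (@assoc_out F x) = x.
Proof.
move: x; apply: (day_ext3l (linear_fcomp associ_out_lin (@assoc_out_lin F))
  (fun _ _ _ => erefl)) => K L f K1 K2 g p q r.
rewrite assoc_outE associ_outE tensm1 compm1 !mcompA fwdK comp1m.
by rewrite -dgen_dinatl /= day_mapE comp1m.
Qed.
Lemma associ_outK x : @assoc_out F (associ_out x) = x.
Proof.
move: x; apply: (day_ext3r (linear_fcomp (@assoc_out_lin F) associ_out_lin)
  (fun _ _ _ => erefl)) => K L f L1 L2 g p q r.
rewrite associ_outE assoc_outE tensm1 compm1 !mcompA bwdK comp1m.
by rewrite -dgen_dinatr /= day_mapE comp1m.
Qed.
End InvOuter.

Lemma associ_out_nat (F G : C) (f : mor F G) (x : day P (day Q S) G) :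
  associ_out (psh_map f x) = psh_map f (associ_out x).
Proof.
move: x; apply: (day_ext3r (linear_fcomp (@associ_out_lin F) (day_map_lin f))
  (linear_fcomp (day_map_lin f) (@associ_out_lin G))) => K L g L1 L2 e p q r.
by rewrite /= day_mapE !associ_outE day_mapE mcompA.
Qed.

Definition day_associ : psh_nat (day P (day Q S)) (day (day P Q) S) :=
  PshNat associ_out_lin associ_out_nat.

Definition day_assoc_iso :
    iso (C := pshcat) (day (day P Q) S) (day P (day Q S)) :=
  @psh_iso (day (day P Q) S) (day P (day Q S)) day_assoc day_associ
    assoc_outK associ_outK.

End DayAssoc.

Section DayUnitors.
Variable P : presheaf.
Let I : presheaf := yo tone.

Lemma psh_map_lincomp (U : lmodType k) (F G : C) (g : U -> lhom F G) (x : P G) :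
  linear g -> linear (fun u => psh_map (g u) x).
Proof. by move=> gl; exact: (linear_fcomp (psh_map_linl x) gl). Qed.

Section Left.
Variable F : C.
Definition lunit_fun : day I P F -> P F :=
  day_lift (fun (K L : C) (f : mor F (K ⊗ L)) (e : I K) (p : P L) =>
    psh_map (lunit L ∘ ((e : mor K tone) ⊗' idm L) ∘ f) p).
Fact lunit_hom (K L : C) (e : mor K tone) (p : P L) :
  linear ((fun f : mor F (K ⊗ L) => psh_map (lunit L ∘ (e ⊗' idm L) ∘ f) p)
    : lhom F (K ⊗ L) -> P F).
Proof. exact: (linear_fcomp (psh_map_linl p) (yo_map_linl _)). Qed.
Fact lunit_l (K L : C) (f : mor F (K ⊗ L)) (p : P L) :
  linear ((fun e : mor K tone => psh_map (lunit L ∘ (e ⊗' idm L) ∘ f) p)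
    : I K -> P F).
Proof.
apply: (linear_fcomp (psh_map_linl p)).
apply: (linear_fcomp (yo_map_linr f)).
exact: (linear_fcomp (yo_map_linl _) (tensm_linl _)).
Qed.
Fact lunit_dinat (K K' L L' : C) (u : mor K K') (v : mor L L')
    (f : mor F (K ⊗ L)) (e : mor K' tone) (p : P L') :
  psh_map (lunit L' ∘ (e ⊗' idm L') ∘ (u ⊗' v ∘ f)) p
  = psh_map (lunit L ∘ ((e ∘ u) ⊗' idm L) ∘ f) (psh_map v p).
Proof.
rewrite -psh_mapM !mcompA -lunit_nat; congr (psh_map (_ ∘ _) _).
rewrite -!mcompA; congr (_ ∘ _).
by rewrite -!tensmM !comp1m compm1.
Qed.
Lemma lunit_lin : linear lunit_fun.
Proof.
apply: day_lift_lin => *;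
  [exact: lunit_hom|exact: lunit_l|exact: psh_map_linr|exact: lunit_dinat].
Qed.
Lemma lunit_gen (K L : C) (f : mor F (K ⊗ L)) (e : mor K tone) (p : P L) :
  lunit_fun (dgen f (e : I K) p) = psh_map (lunit L ∘ (e ⊗' idm L) ∘ f) p.
Proof.
apply: day_lift_gen => *;
  [exact: lunit_hom|exact: lunit_l|exact: psh_map_linr|exact: lunit_dinat].
Qed.

Definition luniti_fun (p : P F) : day I P F :=
  dgen (bwd (lunit F)) (idm (tone : C) : I tone) p.
Lemma luniti_lin : linear luniti_fun. Proof. exact: dgen_lin_r. Qed.
Lemma lunit_funK x : luniti_fun (lunit_fun x) = x.
Proof.
move: x; apply: (day_ext (linear_fcomp luniti_lin lunit_lin)
  (fun _ _ _ => erefl)) => K L f e p.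
rewrite lunit_gen /luniti_fun dgen_dinatr.
have -> : idm tone ⊗' (lunit L ∘ ((e : mor K tone) ⊗' idm L) ∘ f)
    ∘ bwd (lunit F) = (e : mor K tone) ⊗' idm L ∘ f.
  set h := _ ∘ f.
  rewrite -[LHS]comp1m -(fwdK (lunit L)) -!mcompA (mcompA (lunit L)) lunit_nat.
  by rewrite -mcompA bwdK compm1 /h !mcompA fwdK comp1m.
by rewrite dgen_dinat psh_map1 /= comp1m.
Qed.
Lemma luniti_funK p : lunit_fun (luniti_fun p) = p.
Proof. by rewrite lunit_gen tensm1 compm1 bwdK psh_map1. Qed.
End Left.

Lemma lunit_fun_nat (F G : C) (f : mor F G) (x : day I P G) :
  lunit_fun (psh_map f x) = psh_map f (lunit_fun x).
Proof.
move: x; apply: (day_ext (linear_fcomp (@lunit_lin F) (day_map_lin f))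
  (linear_fcomp (psh_map_linr f) (@lunit_lin G))) => K L g e p.
by rewrite /= day_mapE !lunit_gen -psh_mapM mcompA.
Qed.
Lemma luniti_fun_nat (F G : C) (f : mor F G) (p : P G) :
  luniti_fun (psh_map f p) = psh_map f (luniti_fun p).
Proof.
rewrite /= /luniti_fun dgen_dinatr day_mapE; congr (dgen _ _ _).
rewrite -[LHS]comp1m -(fwdK (lunit G)) -mcompA (mcompA (lunit G)) lunit_nat.
by rewrite -(mcompA f) bwdK compm1.
Qed.

Definition day_lunit : iso (C := pshcat) (day I P) P :=
  @psh_iso (day I P) P (PshNat lunit_lin lunit_fun_nat)
    (PshNat luniti_lin luniti_fun_nat) lunit_funK luniti_funK.

Section Right.
Variable F : C.
Definition runit_fun : day P I F -> P F :=
  day_lift (fun (K L : C) (f : mor F (K ⊗ L)) (p : P K) (e : I L) =>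
    psh_map (runit K ∘ (idm K ⊗' (e : mor L tone)) ∘ f) p).
Fact runit_hom (K L : C) (p : P K) (e : mor L tone) :
  linear ((fun f : mor F (K ⊗ L) => psh_map (runit K ∘ (idm K ⊗' e) ∘ f) p)
    : lhom F (K ⊗ L) -> P F).
Proof. exact: (linear_fcomp (psh_map_linl p) (yo_map_linl _)). Qed.
Fact runit_r (K L : C) (f : mor F (K ⊗ L)) (p : P K) :
  linear ((fun e : mor L tone => psh_map (runit K ∘ (idm K ⊗' e) ∘ f) p)
    : I L -> P F).
Proof.
apply: (linear_fcomp (psh_map_linl p)).
apply: (linear_fcomp (yo_map_linr f)).
exact: (linear_fcomp (yo_map_linl _) (tensm_linr _)).
Qed.
Fact runit_dinat (K K' L L' : C) (u : mor K K') (v : mor L L')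
    (f : mor F (K ⊗ L)) (p : P K') (e : mor L' tone) :
  psh_map (runit K' ∘ (idm K' ⊗' e) ∘ (u ⊗' v ∘ f)) p
  = psh_map (runit K ∘ (idm K ⊗' (e ∘ v)) ∘ f) (psh_map u p).
Proof.
rewrite -psh_mapM !mcompA -runit_nat; congr (psh_map (_ ∘ _) _).
rewrite -!mcompA; congr (_ ∘ _).
by rewrite -!tensmM !comp1m compm1.
Qed.
Lemma runit_lin : linear runit_fun.
Proof.
apply: day_lift_lin => *;
  [exact: runit_hom|exact: psh_map_linr|exact: runit_r|exact: runit_dinat].
Qed.
Lemma runit_gen (K L : C) (f : mor F (K ⊗ L)) (p : P K) (e : mor L tone) :
  runit_fun (dgen f p (e : I L)) = psh_map (runit K ∘ (idm K ⊗' e) ∘ f) p.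
Proof.
apply: day_lift_gen => *;
  [exact: runit_hom|exact: psh_map_linr|exact: runit_r|exact: runit_dinat].
Qed.

Definition runiti_fun (p : P F) : day P I F :=
  dgen (bwd (runit F)) p (idm (tone : C) : I tone).
Lemma runiti_lin : linear runiti_fun. Proof. exact: dgen_lin_l. Qed.
Lemma runit_funK x : runiti_fun (runit_fun x) = x.
Proof.
move: x; apply: (day_ext (linear_fcomp runiti_lin runit_lin)
  (fun _ _ _ => erefl)) => K L f p e.
rewrite runit_gen /runiti_fun dgen_dinatl.
have -> : (runit K ∘ (idm K ⊗' (e : mor L tone)) ∘ f) ⊗' idm tone
    ∘ bwd (runit F) = idm K ⊗' (e : mor L tone) ∘ f.
  set h := _ ∘ f.
  rewrite -[LHS]comp1m -(fwdK (runit K)) -!mcompA (mcompA (runit K)) runit_nat.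
  by rewrite -mcompA bwdK compm1 /h !mcompA fwdK comp1m.
by rewrite dgen_dinat psh_map1 /= comp1m.
Qed.
Lemma runiti_funK p : runit_fun (runiti_fun p) = p.
Proof. by rewrite runit_gen tensm1 compm1 bwdK psh_map1. Qed.
End Right.

Lemma runit_fun_nat (F G : C) (f : mor F G) (x : day P I G) :
  runit_fun (psh_map f x) = psh_map f (runit_fun x).
Proof.
move: x; apply: (day_ext (linear_fcomp (@runit_lin F) (day_map_lin f))
  (linear_fcomp (psh_map_linr f) (@runit_lin G))) => K L g p e.
by rewrite /= day_mapE !runit_gen -psh_mapM mcompA.
Qed.
Lemma runiti_fun_nat (F G : C) (f : mor F G) (p : P G) :
  runiti_fun (psh_map f p) = psh_map f (runiti_fun p).
Proof.
rewrite /= /runiti_fun dgen_dinatl day_mapE; congr (dgen _ _ _).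
rewrite -[LHS]comp1m -(fwdK (runit G)) -mcompA (mcompA (runit G)) runit_nat.
by rewrite -(mcompA f) bwdK compm1.
Qed.

Definition day_runit : iso (C := pshcat) (day P I) P :=
  @psh_iso (day P I) P (PshNat runit_lin runit_fun_nat)
    (PshNat runiti_lin runiti_fun_nat) runit_funK runiti_funK.

End DayUnitors.

Lemma day_nat_ext (P Q T : presheaf) (s t : psh_nat (day P Q) T) :
    (forall (F K L : C) (f : mor F (K ⊗ L)) p q, s F (dgen f p q) = t F (dgen f p q)) ->
  s = t.
Proof.
move=> st; apply: psh_nat_ext => F.
exact: (day_ext (@pn_lin _ _ s F) (@pn_lin _ _ t F) (st F)).
Qed.
Lemma day_nat_ext3 (P Q S T : presheaf) (s t : psh_nat (day (day P Q) S) T) :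
    (forall (F K L : C) (f : mor F (K ⊗ L)) (K1 K2 : C) (e : mor K (K1 ⊗ K2)) p q r,
      s F (dgen f (dgen e p q : day P Q K) r)
      = t F (dgen f (dgen e p q : day P Q K) r)) ->
  s = t.
Proof.
move=> st; apply: psh_nat_ext => F.
exact: (day_ext3l (@pn_lin _ _ s F) (@pn_lin _ _ t F) (st F)).
Qed.
Lemma day_nat_ext4 (P Q S T U : presheaf)
    (s t : psh_nat (day (day (day P Q) S) T) U) :
    (forall (F K L : C) (f : mor F (K ⊗ L)) (K1 K2 : C) (e : mor K (K1 ⊗ K2))
        (J1 J2 : C) (d : mor K1 (J1 ⊗ J2)) p q r y,
      s F (dgen f (dgen e (dgen d p q : day P Q K1) r : day (day P Q) S K) y)
      = t F (dgen f (dgen e (dgen d p q : day P Q K1) r : day (day P Q) S K) y)) ->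
  s = t.
Proof.
move=> st; apply: psh_nat_ext => F.
exact: (day_ext4 (@pn_lin _ _ s F) (@pn_lin _ _ t F) (st F)).
Qed.

Definition Day_structure : monoidal_structure pshcat.
Proof.
apply: (@MonoidalStructure pshcat day day_hom (yo tone) day_assoc_iso
  day_lunit day_runit).
- move=> P Q; apply: day_nat_ext => F K L f p q.
  by rewrite /= day_hom_gen.
- move=> P P' P'' Q Q' Q'' s s' t t'; apply: day_nat_ext => F K L f p q.
  by rewrite /= /mcomp /= !day_hom_gen.
- move=> P P' Q Q' S S' s t u; apply: day_nat_ext3 => F K L f K1 K2 e p q r.
  by rewrite /mcomp /= day_hom_gen /= day_hom_gen !assoc_outE !day_hom_gen /= day_hom_gen.
- move=> P P' s; apply: day_nat_ext => F K L f e p.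
  by rewrite /mcomp /= day_hom_gen !lunit_gen pn_nat.
- move=> P P' s; apply: day_nat_ext => F K L f p e.
  by rewrite /mcomp /= day_hom_gen !runit_gen pn_nat.
- move=> P Q S T; apply: day_nat_ext4 => F K L f K1 K2 e J1 J2 d p q r t.
  rewrite /mcomp /= day_hom_gen /= !assoc_outE.
  rewrite day_hom_gen /= assoc_outE tensm1 compm1.
  have -> : dgen (massoc J2 K2 L ∘ idm _) q (dgen (idm (K2 ⊗ L)) r t : day S T _)
      = psh_map (massoc J2 K2 L)
          (dgen (idm _) q (dgen (idm (K2 ⊗ L)) r t : day S T _) : day Q (day S T) _).
    by rewrite /= day_mapE comp1m compm1.
  rewrite dgen_dinatr; congr (dgen _ _ _); rewrite /=.
  have -> : (massoc J1 J2 K2 ∘ (d ⊗' idm K2) ∘ e) ⊗' idm L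
      = massoc J1 J2 K2 ⊗' idm L ∘ ((d ⊗' idm K2) ⊗' idm L) ∘ (e ⊗' idm L).
    by rewrite -!tensmM !comp1m.
  rewrite !mcompA -pentagon.
  congr (_ ∘ _ ∘ _); rewrite -!mcompA; congr (_ ∘ _).
  by rewrite massoc_nat tensm1.
- move=> P Q; apply: day_nat_ext3 => F K L f K1 K2 g p e q.
  rewrite /mcomp /= assoc_outE !day_hom_gen /= lunit_gen runit_gen.
  rewrite compm1 dgen_dinatl dgen_dinatr; congr (dgen _ _ _).
  have -> : (runit K1 ∘ (idm K1 ⊗' (e : mor K2 tone)) ∘ g) ⊗' idm L
      = runit K1 ⊗' idm L ∘ ((idm K1 ⊗' (e : mor K2 tone)) ⊗' idm L) ∘ (g ⊗' idm L).
    by rewrite -!tensmM !comp1m.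
  rewrite -(comp1m (idm K1)) tensmM !comp1m !mcompA -triangle.
  congr (_ ∘ _ ∘ _); rewrite -!mcompA; congr (_ ∘ _).
  by rewrite massoc_nat.
Defined.

Definition Day : moncat := MonCat Day_structure.

Section Yoneda.

Section Mul.
Variables (A B F : C).
Definition yo_mul_fun : day (yo A) (yo B) F -> yo (A ⊗ B) F :=
  day_lift (fun (K L : C) (f : mor F (K ⊗ L)) (p : yo A K) (q : yo B L) =>
    (p : mor K A) ⊗' (q : mor L B) ∘ f : yo (A ⊗ B) F).
Fact yo_mul_hom (K L : C) (p : mor K A) (q : mor L B) :
  linear ((fun f : mor F (K ⊗ L) => p ⊗' q ∘ f)
    : lhom F (K ⊗ L) -> yo (A ⊗ B) F).
Proof. exact: yo_map_linl. Qed.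
Fact yo_mul_l (K L : C) (f : mor F (K ⊗ L)) (q : mor L B) :
  linear ((fun p : mor K A => p ⊗' q ∘ f) : yo A K -> yo (A ⊗ B) F).
Proof. exact: (linear_fcomp (yo_map_linr f) (tensm_linl q)). Qed.
Fact yo_mul_r (K L : C) (f : mor F (K ⊗ L)) (p : mor K A) :
  linear ((fun q : mor L B => p ⊗' q ∘ f) : yo B L -> yo (A ⊗ B) F).
Proof. exact: (linear_fcomp (yo_map_linr f) (tensm_linr p)). Qed.
Fact yo_mul_dinat (K K' L L' : C) (u : mor K K') (v : mor L L')
    (f : mor F (K ⊗ L)) (p : mor K' A) (q : mor L' B) :
  p ⊗' q ∘ (u ⊗' v ∘ f) = (p ∘ u) ⊗' (q ∘ v) ∘ f.
Proof. by rewrite tensmM mcompA. Qed.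
Lemma yo_mul_lin : linear yo_mul_fun.
Proof.
apply: day_lift_lin => *;
  [exact: yo_mul_hom|exact: yo_mul_l|exact: yo_mul_r|exact: yo_mul_dinat].
Qed.
Lemma yo_mul_gen (K L : C) (f : mor F (K ⊗ L)) (p : mor K A) (q : mor L B) :
  yo_mul_fun (dgen f (p : yo A K) (q : yo B L)) = p ⊗' q ∘ f.
Proof.
apply: day_lift_gen => *;
  [exact: yo_mul_hom|exact: yo_mul_l|exact: yo_mul_r|exact: yo_mul_dinat].
Qed.

Definition yo_muli_fun (f : yo (A ⊗ B) F) : day (yo A) (yo B) F :=
  dgen f (idm A : yo A A) (idm B : yo B B).
Lemma yo_muli_lin : linear yo_muli_fun. Proof. exact: dgen_lin_hom. Qed.
Lemma yo_mulK x : yo_muli_fun (yo_mul_fun x) = x.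
Proof.
move: x; apply: (day_ext (linear_fcomp yo_muli_lin yo_mul_lin)
  (fun _ _ _ => erefl)) => K L f p q.
by rewrite yo_mul_gen /yo_muli_fun dgen_dinat /= !comp1m.
Qed.
Lemma yo_muliK f : yo_mul_fun (yo_muli_fun f) = f.
Proof. by rewrite yo_mul_gen tensm1 comp1m. Qed.
End Mul.

Lemma yo_mul_fun_nat (A B F G : C) (f : mor F G) (x : day (yo A) (yo B) G) :
  yo_mul_fun (psh_map f x) = psh_map f (yo_mul_fun x).
Proof.
move: x; apply: (day_ext (linear_fcomp (@yo_mul_lin A B F) (day_map_lin f))
  (linear_fcomp (psh_map_linr f) (@yo_mul_lin A B G))) => K L g p q.
by rewrite /= day_mapE !yo_mul_gen mcompA.
Qed.
Lemma yo_muli_fun_nat (A B F G : C) (f : mor F G) (x : yo (A ⊗ B) G) :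
  yo_muli_fun (psh_map f x) = psh_map f (yo_muli_fun x).
Proof. by rewrite /= day_mapE. Qed.

Definition yo_mul (A B : C) : iso (C := Day) (day (yo A) (yo B)) (yo (A ⊗ B)) :=
  @psh_iso (day (yo A) (yo B)) (yo (A ⊗ B))
    (PshNat (@yo_mul_lin A B) (@yo_mul_fun_nat A B))
    (PshNat (@yo_muli_lin A B) (@yo_muli_fun_nat A B))
    (@yo_mulK A B) (@yo_muliK A B).

(* The unit of Day convolution is yo tone, so the unit comparison is the      *)
(* identity.                                                                  *)
Definition yo_one : iso (C := Day) (yo tone) (yo tone) :=
  @psh_iso (yo tone) (yo tone) (pn_id _) (pn_id _) (fun _ _ => erefl)
    (fun _ _ => erefl).

Definition yoneda : strong_monoidal C Day.
Proof.
apply: (@StrongMonoidal C Day yo yo_hom _ _ yo_mul yo_one).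
- by move=> A; apply: psh_nat_ext => F x; rewrite /= comp1m.
- by move=> A B D g f; apply: psh_nat_ext => F x; rewrite /= [RHS]mcompA.
- move=> A A' B B' f g; apply: day_nat_ext => F K L h p q.
  by rewrite /mcomp /= day_hom_gen !yo_mul_gen /= tensmM mcompA.
- move=> A B D; apply: day_nat_ext3 => F K L f K1 K2 e p q r.
  rewrite /mcomp /= day_hom_gen /= yo_mul_gen assoc_outE day_hom_gen /= !yo_mul_gen.
  have -> : ((p : mor K1 A) ⊗' (q : mor K2 B) ∘ e) ⊗' (r : mor L D)
      = ((p : mor K1 A) ⊗' (q : mor K2 B)) ⊗' (r : mor L D) ∘ (e ⊗' idm L).
    by rewrite -tensmM compm1.
  by rewrite compm1 !mcompA massoc_nat.
- move=> A; apply: day_nat_ext => F K L f e p.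
  rewrite /mcomp /= day_hom_gen /= yo_mul_gen lunit_gen /=.
  rewrite !mcompA -lunit_nat.
  by rewrite -[in RHS](mcompA (lunit A)) -tensmM comp1m compm1.
- move=> A; apply: day_nat_ext => F K L f p e.
  rewrite /mcomp /= day_hom_gen /= yo_mul_gen runit_gen /=.
  rewrite !mcompA -runit_nat.
  by rewrite -[in RHS](mcompA (runit A)) -tensmM comp1m compm1.
Defined.
End Yoneda.
End Presheaves.

Section ModuleCategory.
Variables (k : fieldType) (C : linmoncat k) (M : module_category C).

Definition act (F : C) : endofunctor M := mod_act M F.
Definition act_map (F G : C) (f : mor F G) : nattrans (act F) (act G) :=
  sm_map (mod_act M) f.
Definition act_mul (G F : C) : nattrans (ef_comp (act G) (act F)) (act (G ⊗ F)) :=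
  fwd (sm_mul (mod_act M) G F).
Definition act_muli (G F : C) : nattrans (act (G ⊗ F)) (ef_comp (act G) (act F)) :=
  bwd (sm_mul (mod_act M) G F).
Definition act_one : nattrans (ef_id M) (act tone) := fwd (sm_one (mod_act M)).
Definition act_onei : nattrans (act tone) (ef_id M) := bwd (sm_one (mod_act M)).

Lemma nt_eq (F G : endofunctor M) (s t : nattrans F G) : s = t -> forall X, s X = t X.
Proof. by move=> ->. Qed.

Lemma act_map1 (F : C) (X : M) : act_map (idm F) X = idm (act F X).
Proof. exact: (nt_eq (sm_map1 (mod_act M) F)). Qed.
Lemma act_mapM (F G H : C) (g : mor G H) (f : mor F G) (X : M) :
  act_map (g ∘ f) X = act_map g X ∘ act_map f X.
Proof. exact: (nt_eq (sm_mapM (mod_act M) g f)). Qed.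
Lemma act_map_lin (F G : C) (X : M) :
  linear ((fun f : mor F G => act_map f X) : lhom F G -> lhom (act F X) (act G X)).
Proof. exact: mod_act_lin. Qed.
Lemma act_map_nat (F G : C) (f : mor F G) (X Y : M) (x : mor X Y) :
  act_map f Y ∘ ef_map (act F) x = ef_map (act G) x ∘ act_map f X.
Proof. exact: nt_nat. Qed.
Lemma act_mulK (G F : C) (X : M) : act_muli G F X ∘ act_mul G F X = idm _.
Proof. exact: (nt_eq (fwdK (sm_mul (mod_act M) G F))). Qed.
Lemma act_muliK (G F : C) (X : M) : act_mul G F X ∘ act_muli G F X = idm _.
Proof. exact: (nt_eq (bwdK (sm_mul (mod_act M) G F))). Qed.
Lemma act_oneK (X : M) : act_onei X ∘ act_one X = idm X.
Proof. exact: (nt_eq (fwdK (sm_one (mod_act M)))). Qed.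
Lemma act_oneiK (X : M) : act_one X ∘ act_onei X = idm _.
Proof. exact: (nt_eq (bwdK (sm_one (mod_act M)))). Qed.
Lemma act_muli_nat (G F : C) (X Y : M) (x : mor X Y) :
  act_muli G F Y ∘ ef_map (act (G ⊗ F)) x
  = ef_map (act G) (ef_map (act F) x) ∘ act_muli G F X.
Proof. exact: (nt_nat (act_muli G F)). Qed.
Lemma act_onei_nat (X Y : M) (x : mor X Y) :
  act_onei Y ∘ ef_map (act tone) x = x ∘ act_onei X.
Proof. exact: (nt_nat act_onei). Qed.

Lemma act_muli_map (G G' F F' : C) (g : mor G G') (f : mor F F') (X : M) :
  act_muli G' F' X ∘ act_map (g ⊗' f) X
  = act_map g (act F' X) ∘ ef_map (act G) (act_map f X) ∘ act_muli G F X.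
Proof.
have E : act_mul G' F' X ∘ (act_map g (act F' X) ∘ ef_map (act G) (act_map f X))
    = act_map (g ⊗' f) X ∘ act_mul G F X.
  exact: (nt_eq (sm_mul_nat (mod_act M) g f)).
rewrite -[act_map (g ⊗' f) X]compm1 -act_muliK [act_map _ X ∘ _]mcompA -E.
by rewrite !mcompA act_mulK comp1m.
Qed.

Lemma act_muli_assoc (A B D : C) (X : M) :
  act_muli A B (act D X) ∘ act_muli (A ⊗ B) D X
  = ef_map (act A) (act_muli B D X) ∘ act_muli A (B ⊗ D) X
      ∘ act_map (massoc A B D) X.
Proof.
have E : act_map (massoc A B D) X ∘ act_mul (A ⊗ B) D X ∘ act_mul A B (act D X)
    = act_mul A (B ⊗ D) X ∘ ef_map (act A) (act_mul B D X).
  have := nt_eq (sm_assoc (mod_act M) A B D) X.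
  by rewrite /mcomp /= !ef_map1 comp1m !compm1.
have MmK : ef_map (act A) (act_muli B D X) ∘ ef_map (act A) (act_mul B D X) = idm _.
  by rewrite -ef_mapM act_mulK ef_map1.
have -> : act_map (massoc A B D) X = act_mul A (B ⊗ D) X
    ∘ ef_map (act A) (act_mul B D X) ∘ act_muli A B (act D X) ∘ act_muli (A ⊗ B) D X.
  rewrite -E -(mcompA _ (act_mul A B _)) act_muliK compm1.
  by rewrite -mcompA act_muliK compm1.
by rewrite !mcompA -(mcompA _ (act_muli A (B ⊗ D) X)) act_mulK compm1 MmK comp1m.
Qed.

Lemma act_muli_lunit (A : C) (X : M) :
  act_onei (act A X) ∘ act_muli tone A X = act_map (lunit A) X.
Proof.
have E : act_map (lunit A) X ∘ act_mul tone A X ∘ act_one (act A X) = idm _.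
  have := nt_eq (sm_lunit (mod_act M) A) X.
  by rewrite /mcomp /= compm1.
rewrite -[RHS]compm1 -act_muliK -[act_mul _ _ _]compm1 -act_oneiK !mcompA E.
by rewrite comp1m.
Qed.
Lemma act_muli_runit (A : C) (X : M) :
  ef_map (act A) (act_onei X) ∘ act_muli A tone X = act_map (runit A) X.
Proof.
have E : act_map (runit A) X ∘ act_mul A tone X ∘ ef_map (act A) (act_one X) = idm _.
  have := nt_eq (sm_runit (mod_act M) A) X.
  by rewrite /mcomp /= comp1m.
have MoK : ef_map (act A) (act_one X) ∘ ef_map (act A) (act_onei X) = idm _.
  by rewrite -ef_mapM act_oneiK ef_map1.
rewrite -[LHS]comp1m -E !mcompA -(mcompA _ _ (ef_map _ (act_onei X))) MoK compm1.
by rewrite -mcompA act_muliK compm1.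
Qed.

Section EndomorphismMonoid.
Variable X : M.

Fact end_map1 (F : C) (b : mor (act F X) X) : b ∘ act_map (idm F) X = b.
Proof. by rewrite act_map1 compm1. Qed.
Fact end_mapM (F G H : C) (g : mor G H) (f : mor F G) (b : mor (act H X) X) :
  b ∘ act_map (g ∘ f) X = b ∘ act_map g X ∘ act_map f X.
Proof. by rewrite act_mapM mcompA. Qed.
Fact end_map_linr (F G : C) (f : mor F G) :
  linear ((fun b : mor (act G X) X => b ∘ act_map f X)
    : lhom (act G X) X -> lhom (act F X) X).
Proof. exact: lcomp_linl. Qed.
Fact M_comp_linr (Y Z W : M) (g : mor Z W) :
  linear ((fun f : mor Y Z => g ∘ f) : lhom Y Z -> lhom Y W).
Proof. exact: lcomp_linr. Qed.
Fact M_comp_linl (Y Z W : M) (f : mor Y Z) :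
  linear ((fun g : mor Z W => g ∘ f) : lhom Z W -> lhom Y W).
Proof. exact: lcomp_linl. Qed.
Fact end_map_linl (F G : C) (b : mor (act G X) X) :
  linear ((fun f : mor F G => b ∘ act_map f X)
    : lhom F G -> lhom (act F X) X).
Proof. exact: (linear_fcomp (M_comp_linr b) (act_map_lin X)). Qed.

Definition end_psh : presheaf C :=
  @Presheaf k C (fun F => lhom (act F X) X)
    (fun F G f (b : mor (act G X) X) => b ∘ act_map f X)
    end_map1 end_mapM end_map_linr end_map_linl.

Section Mul.
Variable F : C.
Definition end_mul_gen (K L : C) (f : mor F (K ⊗ L)) (b : mor (act K X) X)
    (c : mor (act L X) X) : mor (act F X) X :=
  b ∘ ef_map (act K) c ∘ act_muli K L X ∘ act_map f X.
Definition end_mul_fun : day end_psh end_psh F -> end_psh F :=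
  day_lift (P := end_psh) (Q := end_psh) (V := end_psh F) end_mul_gen.
Fact end_mul_hom (K L : C) b c :
  linear ((fun f => end_mul_gen f b c) : lhom F (K ⊗ L) -> end_psh F).
Proof. exact: end_map_linl. Qed.
Fact end_mul_l (K L : C) (f : mor F (K ⊗ L)) c :
  linear ((fun b => end_mul_gen f b c) : end_psh K -> end_psh F).
Proof.
apply: (linear_fcomp (M_comp_linl _)); apply: (linear_fcomp (M_comp_linl _)).
exact: M_comp_linl.
Qed.
Fact end_mul_r (K L : C) (f : mor F (K ⊗ L)) b :
  linear ((fun c => end_mul_gen f b c) : end_psh L -> end_psh F).
Proof.
apply: (linear_fcomp (M_comp_linl _)); apply: (linear_fcomp (M_comp_linl _)).
exact: (linear_fcomp (M_comp_linr b) (@ef_lin _ _ (act K) _ _)).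
Qed.
Fact end_mul_dinat (K K' L L' : C) (u : mor K K') (v : mor L L')
    (f : mor F (K ⊗ L)) b c :
  end_mul_gen (u ⊗' v ∘ f) b c
  = end_mul_gen f (b ∘ act_map u X) (c ∘ act_map v X).
Proof.
rewrite /end_mul_gen act_mapM !mcompA -(mcompA _ (act_muli K' L' X)) act_muli_map.
rewrite ef_mapM !mcompA -(mcompA b (ef_map _ c)) -act_map_nat.
by rewrite !mcompA.
Qed.
Lemma end_mul_lin : linear end_mul_fun.
Proof.
apply: day_lift_lin => *;
  [exact: end_mul_hom|exact: end_mul_l|exact: end_mul_r|exact: end_mul_dinat].
Qed.
Lemma end_mulE (K L : C) (f : mor F (K ⊗ L)) (b : mor (act K X) X)
    (c : mor (act L X) X) :
  end_mul_fun (dgen f (b : end_psh K) (c : end_psh L))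
  = b ∘ ef_map (act K) c ∘ act_muli K L X ∘ act_map f X.
Proof.
apply: (day_lift_gen (P := end_psh) (Q := end_psh) (V := end_psh F)) => *;
  [exact: end_mul_hom|exact: end_mul_l|exact: end_mul_r|exact: end_mul_dinat].
Qed.
End Mul.

Lemma end_mul_nat (F G : C) (f : mor F G) (x : day end_psh end_psh G) :
  end_mul_fun (psh_map f x) = psh_map f (end_mul_fun x).
Proof.
move: x; apply: (day_ext (linear_fcomp (@end_mul_lin F) (day_map_lin f))
  (linear_fcomp (psh_map_linr f) (@end_mul_lin G))) => K L g b c.
by rewrite /= day_mapE !end_mulE act_mapM !mcompA.
Qed.
Definition end_mul : psh_nat (day end_psh end_psh) end_psh :=
  PshNat end_mul_lin end_mul_nat.

Fact end_one_lin (F : C) :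
  linear ((fun f : mor F tone => act_onei X ∘ act_map f X)
    : yo tone F -> end_psh F).
Proof. exact: (@end_map_linl F tone (act_onei X)). Qed.
Fact end_one_nat (F G : C) (f : mor F G) (x : mor G tone) :
  act_onei X ∘ act_map (x ∘ f) X = act_onei X ∘ act_map x X ∘ act_map f X.
Proof. by rewrite act_mapM mcompA. Qed.
Definition end_one : psh_nat (yo tone) end_psh :=
  @PshNat k C (yo tone) end_psh
    (fun F (f : mor F tone) => act_onei X ∘ act_map f X) end_one_lin end_one_nat.

Definition end_monoid : monoid_on (V := Day C) end_psh.
Proof.
apply: (@MonoidOn (Day C) end_psh end_mul end_one).
- apply: day_nat_ext3 => F K L f K1 K2 g a b c.
  rewrite /mcomp /= day_hom_gen assoc_outE day_hom_gen /= !end_mulE.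
  rewrite act_map1 compm1 !act_mapM !ef_mapM !mcompA.
  rewrite -(mcompA _ (ef_map _ (act_muli K2 L X))) -(mcompA _ _ (act_map (massoc _ _ _) X)).
  rewrite -act_muli_assoc !mcompA -(mcompA _ (act_muli (K1 ⊗ K2) L X)) act_muli_map.
  rewrite act_map1 ef_map1 compm1 -(mcompA _ (act_map g X)) act_map_nat !mcompA.
  by rewrite -(mcompA _ (act_muli K1 K2 X)) act_muli_nat !mcompA.
- apply: day_nat_ext => F K L f e b.
  rewrite /mcomp /= day_hom_gen lunit_gen /= end_mulE.
  rewrite !act_mapM -act_muli_lunit !mcompA -(mcompA _ (act_muli tone L X)).
  rewrite act_muli_map act_map1 ef_map1 compm1 -(mcompA _ (act_map _ X)) act_map_nat.
  by rewrite !mcompA act_onei_nat.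
- apply: day_nat_ext => F K L f b e.
  rewrite /mcomp /= day_hom_gen runit_gen /= end_mulE.
  rewrite !act_mapM -act_muli_runit !mcompA -(mcompA _ (act_muli K tone X)).
  by rewrite act_muli_map act_map1 comp1m ef_mapM !mcompA.
Defined.

Section Ostrik.
Variables (A : C) (tau : iso (C := pshcat C) (yo A) end_psh).

Definition tau_fwd : psh_nat (yo A) end_psh := fwd tau.
Definition tau_bwd : psh_nat end_psh (yo A) := bwd tau.

Definition ev : mor (act A X) X := tau_fwd A (idm A).

(* Through tau, ostrik_mul corresponds to ev ∘ M(A)(ev) ∘ m^-1 and ostrik_one *)
(* to id_X, under Hom(X, X) = Hom(M(1) X, X) = C(1, A).                       *)
Definition ostrik_mul : mor (A ⊗ A) A :=
  tau_bwd (A ⊗ A) (ev ∘ ef_map (act A) ev ∘ act_muli A A X).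
Definition ostrik_one : mor tone A := tau_bwd tone (idm X ∘ act_onei X).

Lemma pn_eq (P Q : presheaf C) (s t : psh_nat P Q) :
  s = t -> forall F x, s F x = t F x.
Proof. by move=> ->. Qed.
Lemma tau_bwdK (F : C) (b : mor (act F X) X) : tau_fwd F (tau_bwd F b) = b.
Proof. exact: (pn_eq (bwdK tau)). Qed.
Lemma tau_fwdK (F : C) (f : mor F A) : tau_bwd F (tau_fwd F f) = f.
Proof. exact: (pn_eq (fwdK tau)). Qed.
Lemma tau_ev (F : C) (f : mor F A) : tau_fwd F f = ev ∘ act_map f X.
Proof. by rewrite -[f in LHS]comp1m; exact: (pn_nat tau_fwd f (idm A)). Qed.
Lemma ev_inj (F : C) (f g : mor F A) :
  ev ∘ act_map f X = ev ∘ act_map g X -> f = g.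
Proof. by rewrite -!tau_ev => /(congr1 (tau_bwd F)); rewrite !tau_fwdK. Qed.
Lemma ev_mul : ev ∘ act_map ostrik_mul X = ev ∘ ef_map (act A) ev ∘ act_muli A A X.
Proof. by rewrite -tau_ev tau_bwdK. Qed.
Lemma ev_one : ev ∘ act_map ostrik_one X = act_onei X.
Proof. by rewrite -tau_ev tau_bwdK comp1m. Qed.

Definition ostrik_monoid : monoid_on (V := C) A.
Proof.
apply: (@MonoidOn C A ostrik_mul ostrik_one); apply: ev_inj.
- rewrite !act_mapM !mcompA ev_mul -!(mcompA _ (act_muli A A X)) !act_muli_map.
  rewrite !act_map1 ef_map1 compm1 comp1m !mcompA -(mcompA ev _ (act_map ostrik_mul _)).
  rewrite -act_map_nat !mcompA ev_mul -(mcompA _ (act_muli A A X)) act_muli_nat.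
  rewrite -(mcompA _ (ef_map _ ev) (ef_map _ (act_map _ X))) -ef_mapM ev_mul.
  rewrite !ef_mapM !mcompA -!(mcompA (ev ∘ _ ∘ _)) act_muli_assoc.
  by rewrite !mcompA.
- rewrite !act_mapM !mcompA ev_mul -(mcompA _ (act_muli A A X)) act_muli_map.
  rewrite act_map1 ef_map1 compm1 !mcompA -(mcompA ev _ (act_map ostrik_one _)) -act_map_nat.
  by rewrite !mcompA ev_one act_onei_nat -mcompA act_muli_lunit.
- rewrite !act_mapM !mcompA ev_mul -(mcompA _ (act_muli A A X)) act_muli_map.
  rewrite act_map1 comp1m !mcompA -(mcompA _ (ef_map _ ev)) -ef_mapM ev_one.
  by rewrite -mcompA act_muli_runit.
Defined.
End Ostrik.
End EndomorphismMonoid.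
End ModuleCategory.

(* Main.v *)
Require Import Defs.
From mathcomp Require Import all_boot all_algebra.
From mathcomp Require Import boolp.

(** Write A for the representing object.  A monoid structure transported along
    an isomorphism is the only one that makes the isomorphism a morphism of
    monoids ([transport_monoid_unique]), so it suffices that [tau] is a morphism
    from the Yoneda image of Ostrik's monoid to the monoid P = Hom(M(-) X, X).

    By the Yoneda lemma [tau] sends p : F -> A to ev o M(p).  A map out of a Day
    convolution is determined on generators f (x) p (x) q, with p : K -> A,
    q : L -> A and f : F -> K (x) L.  Applying [tau] to both factors and
    multiplying in P gives
      ev o M(p) o M(K)(ev) o M(K)(M(q)) o m^-1 o M(f).
    Naturality of M(p) moves ev to the left of M(p), and naturality of m^-1 then
    moves M(p) and M(q) to its right, where they combine into M(p (x) q).  What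
    remains on the left is ev o M(A)(ev) o m^-1, which is ev o M(mu) for Ostrik's
    multiplication mu.  The result is thus the image under [tau] of
    mu o (p (x) q) o f, the product in the Yoneda image of A
    ([tau_fwd_mul]). *)

Local Open Scope cat_scope.

Lemma monoid_on_ext (V : moncat) (A : V) (m n : monoid_on A) :
  mmul m = mmul n -> munit m = munit n -> m = n.
Proof.
case: m n => [m u ? ? ?] [n v ? ? ?] /= mn uv.
by subst; congr MonoidOn; exact: Prop_irrelevance.
Qed.

(** The transported multiplication is, up to inverting [t], the one forced by
    the requirement that [t] be multiplicative. *)
Lemma transport_monoid_unique (V : moncat) (A B : V) (t : iso A B)
    (m : monoid_on B) (n : monoid_on A) :
    mmul m ∘ (t ⊗' t) = t ∘ mmul n -> munit m = t ∘ munit n ->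
  transport_monoid t m = n.
Proof.
move=> tM t1; apply: monoid_on_ext => /=.
- by rewrite /transport_mul -mcompA tM mcompA fwdK comp1m.
- by rewrite /transport_unit t1 mcompA fwdK comp1m.
Qed.

(** This is multiplicativity of [tau] tested on the generator f (x) p (x) q.
    Sliding M(p) and M(q) rightwards through ev and m^-1 turns the left side
    into ev o M(A)(ev) o m^-1 o M(p (x) q) o M(f), whose first three factors are
    ev o M(mu) by the definition of mu. *)
Lemma tau_fwd_mul (k : fieldType) (C : linmoncat k) (M : module_category C)
    (X : M) (A : C) (tau : iso (C := pshcat C) (yo A) (end_psh X))
    (F K L : C) (f : mor F (K ⊗ L)) (p : mor K A) (q : mor L A) :
  end_mul_gen f (tau_fwd tau K p) (tau_fwd tau L q)
  = tau_fwd tau F (ostrik_mul tau ∘ (p ⊗' q ∘ f)).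
Proof.
rewrite !tau_ev !act_mapM !mcompA ev_mul.
rewrite -(mcompA _ (act_muli M A A X)) act_muli_map.
rewrite /end_mul_gen ef_mapM !mcompA.
by rewrite -(mcompA _ (act_map M p X)) act_map_nat !mcompA.
Qed.

(** Ostrik's unit is the preimage under [tau] of the inverse unit coherence,
    which is the value of the unit of P at the identity of the unit object. *)
Lemma tau_fwd_one (k : fieldType) (C : linmoncat k) (M : module_category C)
    (X : M) (A : C) (tau : iso (C := pshcat C) (yo A) (end_psh X))
    (F : C) (e : mor F tone) :
  end_one X F e = tau_fwd tau F (ostrik_one tau ∘ e).
Proof. by rewrite tau_ev act_mapM mcompA ev_one. Qed.

Theorem corollary10p8 (k : fieldType) (C : linmoncat k) (M : module_category C)
    (X : M) (XX : C) (tau : iso (C := Day C) (yo XX) (end_psh X)) :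
  transport_monoid tau (end_monoid X)
  = map_monoid (yoneda C) (ostrik_monoid tau).
Proof.
apply: transport_monoid_unique.
- apply: day_nat_ext => F K L f p q.
  rewrite /mcomp /= day_hom_gen end_mulE yo_mul_gen.
  exact: tau_fwd_mul.
- apply: psh_nat_ext => F e.
  exact: tau_fwd_one.
Qed.
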